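(* Let $G$ be a group definable in a NIP structure $\mathbf{M}$, and let $\mathcal{M}\subseteq\mathrm{S}_{G,ext}(\mathbf{M})$ be a minimal subflow. Then the Ellis group $\mathbb{G}_{\mathcal{M}}$, equipped with the tau-topology, is Hausdorff.
   Context: A group definable in a first-order structure $\mathbf{M}$ is a definable (with parameters from $\mathbf{M}$) subset $G\subseteq\mathbf{M}^n$ for some $n<\omega$ together with a definable group operation on it. A structure is NIP if its first-order theory is NIP. A subset $S\subseteq G$ is externally definable if $S=G\cap D$, where $D\subseteq\mathfrak{C}^n$ is definable with parameters from a monster model (sufficiently saturated elementary extension) $\mathfrak{C}\succ\mathbf{M}$. $\mathrm{S}_{G,ext}(\mathbf{M})$ is the Stone space of the Boolean algebra of externally definable subsets of $G$ (equivalently, the space of global $n$-types concentrating on $G$ finitely satisfiable in $\mathbf{M}$); it is a flow of the discrete group $G$ under left translation, $gp=\{S:g^{-1}S\in p\}$. A subflow is a nonempty closed $G$-invariant subset; it is minimal if all its orbits are dense. For a minimal flow $X$, the enveloping semigroup is $\mathrm{E}(X)=\overline{\{(gx)_{x\in X}:g\in G\}}\subseteq X^X$, a $G$-flow all of whose minimal subflows are isomorphic; let $M_X$ be one of them. The Ellis group is $\mathbb{G}_X=\mathrm{Aut}(M_X)$, the group of $G$-flow automorphisms of $M_X$. For $X=\mathcal{M}$ as in the claim, $M_{\mathcal{M}}\cong\mathcal{M}$, so $\mathbb{G}_{\mathcal{M}}$ is identified with $\mathrm{Aut}(\mathcal{M})$. The tau-topology on $\mathbb{G}_X$: for $A\subseteq\mathbb{G}_X$,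 $p\in\mathbb{G}_X$, $p\in\mathrm{cl}_\tau(A)$ iff $\{(x,p(x)):x\in M_X\}\subseteq\overline{\bigcup_{q\in A}\{(x,q(x)):x\in M_X\}}$ in $M_X\times M_X$. *)

(* Defs.v *)
From HB Require Import structures.
From mathcomp Require Import all_boot all_classical.
From mathcomp Require Import topology function_spaces subtype_topology.

Set Implicit Arguments.
Unset Strict Implicit.
Unset Printing Implicit Defensive.

Local Open Scope classical_set_scope.
Local Open Scope group_scope.

Record language := Language {
  fun_sym : Type;
  fun_arity : fun_sym -> nat;
  rel_sym : Type;
  rel_arity : rel_sym -> nat }.

(* Terms and formulas have their free variables in an arbitrary type [V];
   a quantifier binds the variable [None] of [option V].  Formulas with
   parameters in [A] are obtained by letting [V] be a sum [I + A], the
   variable [inr a] being interpreted by [a]. *)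
Inductive term (L : language) (V : Type) : Type :=
  | Var of V
  | App (f : fun_sym L) of ('I_(fun_arity f) -> term L V).

Inductive formula (L : language) (V : Type) : Type :=
  | FEq of term L V & term L V
  | FRel (r : rel_sym L) of ('I_(rel_arity r) -> term L V)
  | FNot of formula L V
  | FAnd of formula L V & formula L V
  | FEx of formula L (option V).

Arguments FRel {L V} r _.
Arguments App {L V} f _.

Record structure (L : language) := Structure {
  carrier :> Type;
  fun_interp : forall f : fun_sym L, ('I_(fun_arity f) -> carrier) -> carrier;
  rel_interp : forall r : rel_sym L, ('I_(rel_arity r) -> carrier) -> Prop;
  carrier_inhabited : inhabited carrier }.

Arguments fun_interp {L} s f _.
Arguments rel_interp {L} s r _.

Fixpoint eval (L : language) (M : structure L) (V : Type) (v : V -> M)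
    (t : term L V) : M :=
  match t with
  | Var x => v x
  | App f args => fun_interp M f (fun i => eval v (args i))
  end.

Fixpoint sat (L : language) (M : structure L) (V : Type) (phi : formula L V) :
    (V -> M) -> Prop :=
  match phi with
  | FEq s t => fun v => eval v s = eval v t
  | FRel r args => fun v => rel_interp M r (fun i => eval v (args i))
  | FNot p => fun v => ~ sat p v
  | FAnd p q => fun v => sat p v /\ sat q v
  | FEx p => fun v => exists a : M, sat p (oapp v a)
  end.

Definition join_val (I J T : Type) (v : I -> T) (w : J -> T) : I + J -> T :=
  fun k => match k with inl i => v i | inr j => w j end.

Notation sentence L := (formula L void).

Definition holds (L : language) (M : structure L) (s : sentence L) : Prop :=
  sat s (of_void M).

Definition theory_of (L : language) (M : structure L) : set (sentence L) :=
  [set s | holds M s].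

Definition models (L : language) (N : structure L) (T : set (sentence L)) :=
  T `<=` theory_of N.

(* [phi (x ; y)] with [x] an [n]-tuple and [y] an [m]-tuple of variables. *)
Definition has_IP (L : language) (T : set (sentence L)) (n m : nat)
    (phi : formula L ('I_n + 'I_m)) : Prop :=
  exists2 N : structure L, models N T &
    exists (a : nat -> 'I_n -> N) (b : set nat -> 'I_m -> N),
      forall (i : nat) (I : set nat), sat phi (join_val (a i) (b I)) <-> I i.

Definition NIP_theory (L : language) (T : set (sentence L)) : Prop :=
  forall (n m : nat) (phi : formula L ('I_n + 'I_m)), ~ has_IP T phi.

Definition NIP_structure (L : language) (M : structure L) : Prop :=
  NIP_theory (theory_of M).

Definition elementary (L : language) (M C : structure L) (e : M -> C) : Prop :=
  forall (V : Type) (phi : formula L V) (v : V -> M),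
    sat phi v <-> sat phi (e \o v).

(* [formula L M] is the set of sentences with parameters in [M]; its cardinal
   is [|M| + |L| + aleph_0], so [C] is required to be saturated for the
   successor of that cardinal. *)
Definition saturated_over (L : language) (M C : structure L) : Prop :=
  forall A : set C, (A #<= [set: formula L M])%card ->
  forall Sigma : set (formula L (unit + A)),
    (forall F : set (formula L (unit + A)), finite_set F -> F `<=` Sigma ->
      exists c : C, forall phi, F phi -> sat phi (join_val (fun=> c) set_val)) ->
    exists c : C, forall phi, Sigma phi -> sat phi (join_val (fun=> c) set_val).

Definition definable (L : language) (M : structure L) (I : Type)
    (D : set (I -> M)) : Prop :=
  exists phi : formula L (I + M), D = [set x | sat phi (join_val x id)].

Record definable_group (L : language) (M : structure L) := DefinableGroup {
  dg_dim : nat;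
  dg_dom : set ('I_dg_dim -> M);
  dg_mul : {x | dg_dom x} -> {x | dg_dom x} -> {x | dg_dom x};
  dg_one : {x | dg_dom x};
  dg_inv : {x | dg_dom x} -> {x | dg_dom x};
  dg_dom_definable : definable dg_dom;
  dg_mul_definable : definable
    [set v : ('I_dg_dim + 'I_dg_dim) + 'I_dg_dim -> M | exists x y,
      v = join_val (join_val (sval x) (sval y)) (sval (dg_mul x y))];
  dg_mulA : associative dg_mul;
  dg_mul1g : left_id dg_one dg_mul;
  dg_mulg1 : right_id dg_one dg_mul;
  dg_mulVg : left_inverse dg_one dg_inv dg_mul;
  dg_mulgV : right_inverse dg_one dg_inv dg_mul }.

Definition dg_elt (L : language) (M : structure L) (G : definable_group M) :=
  {x | dg_dom (d := G) x}.

HB.instance Definition _ L M (G : @definable_group L M) :=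
  gen_eqMixin (dg_elt G).
HB.instance Definition _ L M (G : @definable_group L M) :=
  gen_choiceMixin (dg_elt G).
HB.instance Definition _ L M (G : @definable_group L M) :=
  isGroup.Build (dg_elt G) (dg_mulA (d := G)) (dg_mul1g (d := G))
    (dg_mulg1 (d := G)) (dg_mulVg (d := G)) (dg_mulgV (d := G)).

(* [M] is identified with its image under the elementary embedding [e]. *)
Definition ext_definable (L : language) (M C : structure L) (e : M -> C)
    (G : definable_group M) : set (set (dg_elt G)) :=
  [set S | exists2 D : set ('I_(dg_dim G) -> C), definable D &
     S = [set g | D (e \o sval g)]].

Record set_algebra (T : Type) := SetAlgebra {
  alg_sets : set (set T);
  alg_setT : alg_sets setT;
  alg_setC : forall S, alg_sets S -> alg_sets (~` S);
  alg_setI : setI_closed alg_sets }.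

Record stone (T : Type) (B : set_algebra T) := Stone {
  st_sets : set (set T);
  st_sub : st_sets `<=` alg_sets B;
  st_setT : st_sets setT;
  st_set0 : ~ st_sets set0;
  st_setI : setI_closed st_sets;
  st_up : forall S S' : set T,
    alg_sets B S' -> S `<=` S' -> st_sets S -> st_sets S';
  st_ultra : forall S : set T, alg_sets B S -> st_sets S \/ st_sets (~` S) }.

HB.instance Definition _ T (B : set_algebra T) := gen_eqMixin (stone B).
HB.instance Definition _ T (B : set_algebra T) := gen_choiceMixin (stone B).

Definition stone_basic (T : Type) (B : set_algebra T) (S : set T) :
  set (stone B) := [set p | st_sets p S].
Arguments stone_basic {T} B S _.

Section StoneTopology.
Variables (T : Type) (B : set_algebra T).

Lemma stone_ext (p q : stone B) : st_sets p = st_sets q -> p = q.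
Proof.
case: p q => [p p1 p2 p3 p4 p5 p6] [q q1 q2 q3 q4 q5 q6] /= pq; subst q.
by congr Stone; exact: Prop_irrelevance.
Qed.

Lemma stone_setC (p : stone B) S :
  alg_sets B S -> st_sets p (~` S) <-> ~ st_sets p S.
Proof.
move=> BS; split=> [pC pS|npS].
  by apply: (@st_set0 _ _ p); rewrite -(setICr S); exact: st_setI.
by have [] := st_ultra p BS.
Qed.

Lemma stone_basic_cover : \bigcup_(S in alg_sets B) stone_basic B S = setT.
Proof.
rewrite predeqE => p; split=> // _; exists setT; first exact: alg_setT.
exact: st_setT.
Qed.

Lemma stone_basic_join (S S' : set T) (p : stone B) :
  alg_sets B S -> alg_sets B S' ->
  stone_basic B S p -> stone_basic B S' p ->
  exists R, [/\ alg_sets B R, stone_basic B R p &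
    stone_basic B R `<=` stone_basic B S `&` stone_basic B S'].
Proof.
move=> BS BS' pS pS'; exists (S `&` S'); split; first exact: alg_setI.
  exact: st_setI.
move=> q qI; split.
  exact: (st_up BS (@subIsetl _ _ _) qI).
exact: (st_up BS' (@subIsetr _ _ _) qI).
Qed.

HB.instance Definition _ := isBaseTopological.Build (stone B)
  stone_basic_cover stone_basic_join.

Lemma stone_basic_open S : alg_sets B S -> open (stone_basic B S).
Proof.
move=> BS; exists [set S]; last by rewrite bigcup_set1.
by move=> _ ->.
Qed.

Lemma stone_nbhs (p : stone B) (U : set (stone B)) : nbhs p U ->
  exists S, [/\ alg_sets B S, st_sets p S & stone_basic B S `<=` U].
Proof.
move=> [_ [[D DB <-] [S DS pS] DU]]; exists S; split=> //; first exact: DB.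
by move=> q qS; apply: DU; exists S.
Qed.

Lemma stone_hausdorff : hausdorff_space (stone B).
Proof.
move=> p q pq; apply: stone_ext; rewrite predeqE.
have key S : alg_sets B S -> st_sets p S -> st_sets q S.
  move=> BS pS; apply: contrapT => /(stone_setC q BS) qS.
  have [r [rS rC]] : stone_basic B S `&` stone_basic B (~` S) !=set0.
    by apply: pq; apply: open_nbhs_nbhs; split=> //; apply: stone_basic_open => //;
      exact: alg_setC.
  by move/(stone_setC r BS): rC; apply.
move=> S; split=> [pS|qS]; first exact: key (st_sub pS) pS.
have BS := st_sub qS; apply: contrapT => /(stone_setC p BS) pC.
by have /(stone_setC q BS) := key _ (alg_setC BS) pC.
Qed.

Lemma stone_compact : compact [set: stone B].
Proof.
rewrite compact_ultra => F FU _.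
pose p := [set S | alg_sets B S /\ F (stone_basic B S)].
have pT : p setT.
  split; first exact: alg_setT.
  by apply: filterS filterT => q _; exact: st_setT.
have p0 : ~ p set0.
  move=> [_ F0]; have [q] := filter_ex F0; exact: st_set0.
have pI : setI_closed p.
  move=> S S' [BS FS] [BS' FS']; split; first exact: alg_setI.
  by apply: filterS (filterI FS FS') => q [? ?]; exact: st_setI.
have pU (S S' : set T) : alg_sets B S' -> S `<=` S' -> p S -> p S'.
  move=> BS' SS' [BS FS]; split=> //.
  by apply: filterS FS => q; exact: st_up.
have pultra (S : set T) : alg_sets B S -> p S \/ p (~` S).
  move=> BS; have [FS|FS] := in_ultra_setVsetC (stone_basic B S) FU.
    by left.
  right; split; first exact: alg_setC.
  by apply: filterS FS => q /(stone_setC q BS).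
pose P := @Stone T B p (fun S => @proj1 _ _) pT p0 pI pU pultra.
exists P; split=> // U /stone_nbhs [S [BS [_ FS] SU]].
exact: filterS FS.
Qed.

End StoneTopology.

Record flow (G : groupType) := Flow {
  fspace :> topologicalType;
  fact : G -> fspace -> fspace;
  fact1 : forall x, fact 1 x = x;
  factM : forall g h x, fact (g * h) x = fact g (fact h x);
  fact_continuous : forall g, continuous (fact g);
  fspace_compact : compact [set: fspace];
  fspace_hausdorff : hausdorff_space fspace }.

Arguments fact {G f} g x.

Definition orbit_set (G : groupType) (X : flow G) (x : X) : set X :=
  range (fun g : G => fact g x).

Record subflow (G : groupType) (X : flow G) := Subflow {
  sf_set : set X;
  sf_nonempty : sf_set !=set0;
  sf_closed : closed sf_set;
  sf_invariant : forall g x, sf_set x -> sf_set (fact g x) }.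

Definition minimal (G : groupType) (X : flow G) : Prop :=
  [set: X] !=set0 /\ forall x : X, dense (orbit_set x).

Section SubflowFlow.
Variables (G : groupType) (X : flow G) (Y : subflow X).

Definition sf_act (g : G) (y : sf_set Y) : sf_set Y :=
  exist _ (fact g (set_val y))
    (mem_set (sf_invariant g (set_mem (valP y)))).

Lemma sf_act1 y : sf_act 1 y = y.
Proof. by apply: val_inj => /=; rewrite fact1. Qed.

Lemma sf_actM g h y : sf_act (g * h) y = sf_act g (sf_act h y).
Proof. by apply: val_inj => /=; rewrite factM. Qed.

Lemma sf_val_continuous : continuous (set_val : sf_set Y -> X).
Proof. exact: initial_continuous. Qed.

Lemma sf_act_continuous g : continuous (sf_act g).
Proof.
apply/continuousP => _ [U oU <-].
exists (fact g @^-1` U); last by [].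
by move/continuousP: (@fact_continuous _ X g); apply.
Qed.

Lemma sf_compact : compact [set: sf_set Y].
Proof.
rewrite compact_ultra => F FU _.
have cY : compact (sf_set Y).
  exact: subclosed_compact (@sf_closed _ _ Y) (@fspace_compact _ X) _.
have FP : ProperFilter (set_val @ F) by exact: fmap_proper_filter.
have [x [Yx clx]] : sf_set Y `&` cluster (set_val @ F) !=set0.
  apply: cY; change (F (set_val @^-1` sf_set Y)).
  suff -> : set_val @^-1` sf_set Y = [set: sf_set Y] by exact: filterT.
  by rewrite predeqE => y; split=> // _; exact: set_mem (valP y).
exists (exist _ x (mem_set Yx)); split=> // U [_ [[V oV <-] Vx VU]].
apply: filterS VU _.
have [//|FC] := in_ultra_setVsetC (set_val @^-1` V) FU.
have [z [nVz Vz]] : ~` V `&` V !=set0.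
  apply: clx; first exact: FC.
  exact: open_nbhs_nbhs.
by [].
Qed.

Lemma sf_hausdorff : hausdorff_space (sf_set Y).
Proof.
move=> p q pq; apply: val_inj; apply: (@fspace_hausdorff _ X) => U V pU qV.
have [r [Ur Vr]] := pq _ _ (sf_val_continuous pU) (sf_val_continuous qV).
by exists (set_val r).
Qed.

Definition subflow_flow : flow G :=
  Flow sf_act1 sf_actM sf_act_continuous sf_compact sf_hausdorff.

End SubflowFlow.

Coercion subflow_flow : subflow >-> flow.

Record minimal_subflow (G : groupType) (X : flow G) := MinimalSubflow {
  ms_subflow :> subflow X;
  ms_minimal : minimal ms_subflow }.

Section PowerFlow.
Variables (G : groupType) (X : flow G).

Definition pow_act (g : G) (f : {ptws X -> X}) : {ptws X -> X} :=
  fun x => fact g (f x).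

Lemma pow_act1 f : pow_act 1 f = f.
Proof. by apply/funext => x; rewrite /pow_act fact1. Qed.

Lemma pow_actM g h f : pow_act (g * h) f = pow_act g (pow_act h f).
Proof. by apply/funext => x; rewrite /pow_act factM. Qed.

Lemma pow_proj_continuous (x : X) : continuous (fun f : {ptws X -> X} => f x).
Proof. exact: (@proj_continuous X (fun=> X) x). Qed.

Lemma pow_act_continuous g : continuous (pow_act g).
Proof.
move=> f; have FF : Filter (pow_act g @ nbhs (f : {ptws X -> X})).
  exact: fmap_filter.
apply/cvg_sup => x; apply/cvg_image.
  rewrite predeqE => y; split=> // _; by exists (fun=> y).
move=> U nU.
pose h := fun f : {ptws X -> X} => fact g (f x).
have ch : {for f, continuous h}.
  by apply: continuous_comp; [exact: pow_proj_continuous|exact: fact_continuous].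
have nh : nbhs f (h @^-1` U) by exact: ch.
exists ((fun k : X -> X => k x) @^-1` U).
  exact: nh.
by rewrite image_preimage //; rewrite predeqE => y; split=> // _; exists (fun=> y).
Qed.

Lemma pow_compact : compact [set: {ptws X -> X}].
Proof.
have := @tychonoff X (fun=> X) (fun=> setT) (fun=> @fspace_compact _ X).
by congr (compact _); rewrite predeqE.
Qed.

Lemma pow_hausdorff : hausdorff_space {ptws X -> X}.
Proof. exact: (@hausdorff_product X (fun=> X) (fun=> @fspace_hausdorff _ X)). Qed.

Definition power_flow : flow G :=
  Flow pow_act1 pow_actM pow_act_continuous pow_compact pow_hausdorff.

Definition enveloping_set : set power_flow :=
  closure (range (fun g : G => (fun x : X => fact g x) : power_flow)).

Lemma enveloping_nonempty : enveloping_set !=set0.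
Proof. by exists (fact 1); apply: subset_closure; exists 1. Qed.

Lemma enveloping_closed : closed enveloping_set.
Proof. exact: closed_closure. Qed.

Lemma enveloping_invariant g f : enveloping_set f -> enveloping_set (fact g f).
Proof.
move=> Ef U /(@fact_continuous _ power_flow g f) /Ef [_ [[h _ <-] Uh]].
exists (fact (g * h)); split; first by exists (g * h).
suff -> : (fact (g * h) : X -> X) = pow_act g (fact h) by [].
by apply/funext => x; rewrite factM.
Qed.

Definition enveloping_semigroup : subflow power_flow :=
  Subflow enveloping_nonempty enveloping_closed enveloping_invariant.

End PowerFlow.

Record aut (G : groupType) (X : flow G) := Aut {
  aut_fun :> X -> X;
  aut_equivariant : forall g x, aut_fun (fact g x) = fact g (aut_fun x);
  aut_continuous : continuous aut_fun;
  aut_invertible : exists2 h : X -> X, continuous h &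
    cancel aut_fun h /\ cancel h aut_fun }.

HB.instance Definition _ G (X : flow G) := gen_eqMixin (aut X).
HB.instance Definition _ G (X : flow G) := gen_choiceMixin (aut X).

Section AutGroup.
Variables (G : groupType) (X : flow G).

Lemma aut_ext (p q : aut X) : p =1 q -> p = q.
Proof.
case: p q => [p p1 p2 p3] [q q1 q2 q3] /= /funext pq; subst q.
by congr Aut; exact: Prop_irrelevance.
Qed.

Lemma aut_id_invertible : exists2 h : X -> X, continuous h &
  cancel id h /\ cancel h id.
Proof. by exists id; [move=> x; exact: cvg_id|]. Qed.

Definition aut_id : aut X :=
  @Aut G X id (fun _ _ => erefl) (fun=> cvg_id) aut_id_invertible.

Section Comp.
Variables p q : aut X.

Lemma aut_comp_equivariant g x : (p \o q) (fact g x) = fact g ((p \o q) x).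
Proof. by rewrite /= !aut_equivariant. Qed.

Lemma aut_comp_continuous : continuous (p \o q).
Proof. by move=> x; apply: continuous_comp; exact: aut_continuous. Qed.

Lemma aut_comp_invertible : exists2 h : X -> X, continuous h &
  cancel (p \o q) h /\ cancel h (p \o q).
Proof.
have [h ch [ph hp]] := aut_invertible p.
have [k ck [qk kq]] := aut_invertible q.
exists (k \o h); first by move=> x; apply: continuous_comp; [exact: ch|exact: ck].
by split; apply: can_comp.
Qed.

Definition aut_comp : aut X :=
  Aut aut_comp_equivariant aut_comp_continuous aut_comp_invertible.

End Comp.

Lemma aut_inv_ex (p : aut X) : exists q : aut X, cancel p q /\ cancel q p.
Proof.
have [h ch [ph hp]] := aut_invertible p.
have eqh g x : h (fact g x) = fact g (h x).
  by rewrite -{1}(hp x) -aut_equivariant ph.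
have ih : exists2 k : X -> X, continuous k & cancel h k /\ cancel k h.
  by exists p; [exact: aut_continuous|].
by exists (Aut eqh ch ih).
Qed.

Definition aut_inv (p : aut X) : aut X := projT1 (cid (aut_inv_ex p)).

Lemma aut_invK (p : aut X) : cancel p (aut_inv p) /\ cancel (aut_inv p) p.
Proof. exact: projT2 (cid (aut_inv_ex p)). Qed.

Lemma aut_compA : associative aut_comp.
Proof. by move=> p q r; apply: aut_ext. Qed.

Lemma aut_comp1 : left_id aut_id aut_comp.
Proof. by move=> p; apply: aut_ext. Qed.

Lemma aut_1comp : right_id aut_id aut_comp.
Proof. by move=> p; apply: aut_ext. Qed.

Lemma aut_compV : left_inverse aut_id aut_inv aut_comp.
Proof. by move=> p; apply: aut_ext => x /=; rewrite (aut_invK p).1. Qed.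

Lemma aut_Vcomp : right_inverse aut_id aut_inv aut_comp.
Proof. by move=> p; apply: aut_ext => x /=; rewrite (aut_invK p).2. Qed.

HB.instance Definition _ :=
  isGroup.Build (aut X) aut_compA aut_comp1 aut_1comp aut_compV aut_Vcomp.

End AutGroup.

Section Tau.
Variables (G : groupType) (X : flow G).

Definition aut_graph (p : aut X) : set (X * X) := range (fun x => (x, p x)).

Definition cl_tau (A : set (aut X)) : set (aut X) :=
  [set p | aut_graph p `<=` closure (\bigcup_(q in A) aut_graph q)].

Definition tau_open (U : set (aut X)) : Prop := cl_tau (~` U) `<=` ~` U.

Lemma cl_tau_sub A : A `<=` cl_tau A.
Proof.
by move=> p Ap z pz; apply: subset_closure; exists p.
Qed.

Lemma cl_tauS A A' : A `<=` A' -> cl_tau A `<=` cl_tau A'.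
Proof.
move=> AA' p pA; apply: subset_trans pA _; apply: closureS.
exact: bigcup_subset.
Qed.

Lemma cl_tau_idem A : cl_tau (cl_tau A) = cl_tau A.
Proof.
apply/seteqP; split; last exact: cl_tau_sub.
move=> p pA; apply: (subset_trans pA).
have /closure_id -> := @closed_closure _ (\bigcup_(q in A) aut_graph q).
by apply: closureS => z [q qA qz]; exact: qA.
Qed.

Hypothesis minX : minimal X.

Lemma cl_tau0 : cl_tau set0 = set0.
Proof.
rewrite -subset0 => p pA; have [x _] := minX.1.
have := pA (x, p x) (ex_intro2 _ _ x I erefl).
by rewrite bigcup_set0 closure0.
Qed.

Lemma cl_tau_mem (p : aut X) (A : set (aut X)) (x : X) :
  closure (\bigcup_(q in A) aut_graph q) (x, p x) -> cl_tau A p.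
Proof.
move=> clx _ [y _ <-] W nW.
have cf : continuous (fun z : X => (z, p z)).
  by move=> z; apply: cvg_pair; [exact: cvg_id|exact: aut_continuous].
have /(cf y) : nbhs (y, p y) W° by exact: nbhs_interior.
rewrite nbhsE => -[O [oO Oy] OW].
have [u [Ou [g _ gz]]] := minX.2 x O (ex_intro _ y Oy) oO.
have gW : W° (fact g x, fact g (p x)).
  by rewrite -aut_equivariant gz; exact: (OW _ Ou).
have cg : continuous (fun z : X * X => (fact g z.1, fact g z.2)).
  move=> z; apply: cvg_pair; apply: continuous_comp;
    by [exact: cvg_fst|exact: cvg_snd|exact: fact_continuous].
have [_ [[q Aq [z _ <-]] Wz]] := clx _ (cg (x, p x) _ gW).
exists (fact g z, q (fact g z)); split; first by exists q => //; exists (fact g z).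
by rewrite aut_equivariant.
Qed.

Lemma cl_tauU A A' : cl_tau (A `|` A') = cl_tau A `|` cl_tau A'.
Proof.
apply/seteqP; split=> p; last first.
  by move=> [|]; apply: cl_tauS; [exact: subsetUl|exact: subsetUr].
have [x _] := minX.1 => /(_ (x, p x) (ex_intro2 _ _ x I erefl)).
rewrite bigcup_setU closureU => -[clx|clx]; [left|right]; exact: cl_tau_mem clx.
Qed.

Lemma tau_openT : tau_open setT.
Proof. by rewrite /tau_open setCT cl_tau0. Qed.

Lemma tau_openI : setI_closed tau_open.
Proof.
move=> U V oU oV; rewrite /tau_open setCI cl_tauU.
by move=> p [/oU|/oV]; [left|right].
Qed.

Lemma tau_open_bigU (I : Type) (U : I -> set (aut X)) :
  (forall i, tau_open (U i)) -> tau_open (\bigcup_i U i).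
Proof.
move=> oU; rewrite /tau_open setC_bigcup => p pcl i _; apply: (oU i).
by apply: cl_tauS pcl => q; apply.
Qed.

End Tau.

(* The minimal subflows of the enveloping semigroup are all isomorphic; the
   Ellis group is computed from any choice [N] of one of them. *)
Definition ellis_group (G : groupType) (X : flow G)
  (N : minimal_subflow (enveloping_semigroup X)) : Type := aut N.

HB.instance Definition _ G X N := Group.on (@ellis_group G X N).
HB.instance Definition _ G X N := isOpenTopological.Build (@ellis_group G X N)
  (tau_openT (ms_minimal N)) (tau_openI (ms_minimal N))
  (@tau_open_bigU G N).

Lemma closure_ellis_group (G : groupType) (X : flow G)
    (N : minimal_subflow (enveloping_semigroup X)) (A : set (ellis_group N)) :
  closure A = cl_tau A.
Proof.
have tauE (U : set (ellis_group N)) : open U = tau_open U by [].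
apply/seteqP; split.
  have : closed (cl_tau A : set (ellis_group N)).
    by rewrite -openC tauE /tau_open setCK cl_tau_idem.
  by move=> /closure_id ->; apply: closureS; exact: cl_tau_sub.
move=> p pA; have : open (~` closure A) by rewrite openC; exact: closed_closure.
rewrite tauE /tau_open setCK; apply; apply: cl_tauS pA.
exact: (@subset_closure (ellis_group N) A).
Qed.

Section StoneFlow.
Variables (G : groupType) (B : set_algebra G).

Definition left_translate (g : G) (S : set G) : set G := [set g * x | x in S].

Hypothesis Btrans : forall g S, alg_sets B S -> alg_sets B (left_translate g S).

Lemma left_translateE g S : left_translate g S = [set x | S (g^-1 * x)].
Proof.
apply/seteqP; split=> [_ [x Sx <-] /=|x Sx]; first by rewrite mulKg.
by exists (g^-1 * x) => //; rewrite mulVKg.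
Qed.

Section Act.
Variables (g : G) (p : stone B).

Definition stone_act_sets : set (set G) :=
  [set S | st_sets p (left_translate g^-1 S)].

Lemma stone_act_sub : stone_act_sets `<=` alg_sets B.
Proof.
move=> S /st_sub /(Btrans g); rewrite !left_translateE invgK.
by congr (alg_sets B _); apply/funext => x /=; rewrite mulVKg.
Qed.

Lemma stone_act_setT : stone_act_sets setT.
Proof.
by rewrite /stone_act_sets /= left_translateE; exact: st_setT.
Qed.

Lemma stone_act_set0 : ~ stone_act_sets set0.
Proof.
by rewrite /stone_act_sets /= left_translateE; exact: st_set0.
Qed.

Lemma stone_act_setI : setI_closed stone_act_sets.
Proof.
move=> S S'; rewrite /stone_act_sets /= !left_translateE; exact: st_setI.
Qed.

Lemma stone_act_up S S' : alg_sets B S' -> S `<=` S' ->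
  stone_act_sets S -> stone_act_sets S'.
Proof.
move=> BS' SS'; apply: st_up; first exact: Btrans.
exact: image_subset.
Qed.

Lemma stone_act_ultra S : alg_sets B S ->
  stone_act_sets S \/ stone_act_sets (~` S).
Proof.
move=> /(Btrans g^-1) /(st_ultra p).
by rewrite /stone_act_sets /= !left_translateE.
Qed.

Definition stone_act : stone B :=
  Stone stone_act_sub stone_act_setT stone_act_set0 stone_act_setI
    stone_act_up stone_act_ultra.

End Act.

Lemma stone_act1 p : stone_act 1 p = p.
Proof.
apply: stone_ext; apply/funext => S /=; congr (st_sets p _).
by rewrite left_translateE; apply/funext => x /=; rewrite invgK mul1g.
Qed.

Lemma stone_actM g h p : stone_act (g * h) p = stone_act g (stone_act h p).
Proof.
apply: stone_ext; apply/funext => S /=; congr (st_sets p _).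
by rewrite !left_translateE; apply/funext => x /=; rewrite !invgK mulgA.
Qed.

Lemma stone_act_continuous g : continuous (stone_act g).
Proof.
move=> p U /stone_nbhs [S [BS pS SU]].
have : nbhs p (stone_basic B (left_translate g^-1 S)).
  by apply: open_nbhs_nbhs; split=> //; apply: stone_basic_open; exact: Btrans.
by apply: filterS => q qS; exact: SU.
Qed.

(* [g p = {S : g^-1 S \in p}] *)
Definition stone_flow : flow G :=
  Flow stone_act1 stone_actM stone_act_continuous
    (@stone_compact _ B) (@stone_hausdorff _ B).

End StoneFlow.

Section ExtDefinableAlgebra.
Variable L : language.

Fixpoint rename_term (V W : Type) (f : V -> W) (t : term L V) : term L W :=
  match t with
  | Var x => Var L (f x)
  | App h args => App h (fun i => rename_term f (args i))
  end.

Fixpoint rename (V : Type) (phi : formula L V) :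
    forall W : Type, (V -> W) -> formula L W :=
  match phi with
  | FEq s t => fun W f => FEq (rename_term f s) (rename_term f t)
  | FRel r args => fun W f => FRel r (fun i => rename_term f (args i))
  | FNot p => fun W f => FNot (rename p f)
  | FAnd p q => fun W f => FAnd (rename p f) (rename q f)
  | FEx p => fun W f => FEx (rename p (omap f))
  end.

Lemma eval_rename (N : structure L) V W (f : V -> W) (t : term L V)
    (v : W -> N) : eval v (rename_term f t) = eval (v \o f) t.
Proof.
elim: t => [//|h args IH] /=; congr (fun_interp _ _ _).
by apply/funext => i; exact: IH.
Qed.

Lemma sat_rename (N : structure L) V (phi : formula L V) :
  forall W (f : V -> W) (v : W -> N),
    sat (rename phi f) v <-> sat phi (v \o f).
Proof.
elim: phi => {V} [V s t|V r args|V p IH|V p IHp q IHq|V p IH] W f v /=.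
- by rewrite !eval_rename.
- suff -> : (fun i => eval v (rename_term f (args i))) =
            (fun i => eval (v \o f) (args i)) by [].
  by apply/funext => i; exact: eval_rename.
- by rewrite IH.
- by rewrite IHp IHq.
- have E a : oapp v a \o omap f = oapp (v \o f) a by apply/funext => -[].
  by split=> -[a]; [move=> /IH; rewrite E|rewrite -E => /IH]; exists a.
Qed.

Lemma ex_block (n : nat) (V : Type) (phi : formula L (V + 'I_n)) :
  exists psi : formula L V, forall (N : structure L) (v : V -> N),
    sat psi v <-> exists z : 'I_n -> N, sat phi (join_val v z).
Proof.
elim: n phi => [|n IH] phi.
  pose f (k : V + 'I_0) : V := match k with
    | inl x => x | inr i => False_rect V (notF (ltn_ord i)) end.
  exists (rename phi f) => N v; rewrite sat_rename.
  have E z : join_val v z = v \o f by apply/funext => -[//|[]].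
  by split=> [?|[z]]; [exists (v \o (f \o inr)); rewrite E|rewrite E].
pose f (k : V + 'I_n.+1) : option (V + 'I_n) := match k with
  | inl x => Some (inl x) | inr i => omap inr (unlift ord0 i) end.
have [psi psiP] := IH (FEx (rename phi f)).
exists psi => N v; rewrite psiP /=; split=> [[z [a]]|[z]].
  rewrite sat_rename => h.
  exists (fun i => oapp z a (unlift ord0 i)).
  suff <- : oapp (join_val v z) a \o f =
    join_val v (fun i => oapp z a (unlift ord0 i)) by [].
  by apply/funext => -[//|i] /=; case: (unlift ord0 i).
move=> h; exists (z \o lift ord0), (z ord0); rewrite sat_rename.
suff -> : oapp (join_val v (z \o lift ord0)) (z ord0) \o f = join_val v z by [].
by apply/funext => -[//|i] /=; case: unliftP => [j|] ->.
Qed.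

Variables (M C : structure L) (e : M -> C) (G : definable_group M).

Lemma ext_definable_setT : ext_definable e (G := G) setT.
Proof.
exists setT => //; exists (FEx (FEq (Var L None) (Var L None))).
by rewrite predeqE => x; split=> // _; have [c] := carrier_inhabited C; exists c.
Qed.

Lemma ext_definable_setC (S : set (dg_elt G)) :
  ext_definable e S -> ext_definable e (~` S).
Proof.
by move=> [_ [phi ->] ->]; exists (~` [set x | sat phi (join_val x id)]);
  [exists (FNot phi)|].
Qed.

Lemma ext_definable_setI : setI_closed (ext_definable e (G := G)).
Proof.
move=> _ _ [_ [phi ->] ->] [_ [psi ->] ->].
exists ([set x | sat phi (join_val x id)] `&` [set x | sat psi (join_val x id)]).
  by exists (FAnd phi psi).
by [].
Qed.

Definition ext_definable_algebra : set_algebra (dg_elt G) :=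
  SetAlgebra ext_definable_setT ext_definable_setC ext_definable_setI.

Hypothesis elem_e : elementary e.

Lemma ext_definable_translate (g : dg_elt G) (S : set (dg_elt G)) :
  ext_definable e S -> ext_definable e (left_translate g S).
Proof.
rewrite left_translateE => -[_ [phi ->] ->] /=.
set k : dg_elt G := g^-1; set n := dg_dim G in phi *.
have [Gam GamE] := dg_mul_definable G.
have GamP (x y : dg_elt G) (z : 'I_n -> M) :
    sat Gam (join_val (join_val (join_val (sval x) (sval y)) z) id) <->
    z = sval (x * y).
  have := congr1 (fun P : set _ =>
    P (join_val (join_val (sval x) (sval y)) z)) GamE => /= <-.
  split=> [[x' [y' E]]|->]; last by exists x, y.
  have Ex : x = x' by apply: eq_sig_hprop => [?|];
    [exact: Prop_irrelevance|apply/funext => i; exact: (congr1 (@^~ (inl (inl i))) E)].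
  have Ey : y = y' by apply: eq_sig_hprop => [?|];
    [exact: Prop_irrelevance|apply/funext => i; exact: (congr1 (@^~ (inl (inr i))) E)].
  by subst x' y'; apply/funext => i; exact: (congr1 (@^~ (inr i)) E).
have GamC (x y : dg_elt G) (z : 'I_n -> C) :
    sat Gam (join_val (join_val (join_val (e \o sval x) (e \o sval y)) z) e) <->
    z = e \o sval (x * y).
  split=> [h|->]; last first.
    have /elem_e := (GamP x y _).2 erefl; congr (sat Gam _).
    by apply/funext => -[[[]|]|].
  apply/funext => i; apply: contrapT => ne.
  pose f (j : ('I_n + 'I_n) + 'I_n + M) : M + 'I_n := match j with
    | inl (inl (inl j)) => inl (sval x j)
    | inl (inl (inr j)) => inl (sval y j)
    | inl (inr j) => inr j
    | inr m => inl m end.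
  have [psi psiP] := ex_block (FAnd (rename Gam f)
    (FNot (FEq (Var L (inr i)) (Var L (inl (sval (x * y) i)))))).
  have : sat psi (e \o id).
    rewrite psiP; exists z; split; last exact: ne.
    rewrite sat_rename; move: h; congr (sat Gam _).
    by apply/funext => -[[[]|]|].
  move=> /elem_e; rewrite psiP => -[w /= []]; rewrite sat_rename => h' ne'.
  apply: ne' => /=; suff -> : w = sval (x * y) by [].
  apply/GamP; move: h'; congr (sat Gam _).
  by apply/funext => -[[[]|]|].
pose fG (j : ('I_n + 'I_n) + 'I_n + M) : 'I_n + C + 'I_n := match j with
  | inl (inl (inl j)) => inl (inr (e (sval k j)))
  | inl (inl (inr j)) => inl (inl j)
  | inl (inr j) => inr j
  | inr m => inl (inr (e m)) end.
pose fphi (j : 'I_n + C) : 'I_n + C + 'I_n := match j with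
  | inl j => inr j
  | inr c => inl (inr c) end.
have [psi psiP] := ex_block (FAnd (rename Gam fG) (rename phi fphi)).
exists [set x | sat psi (join_val x id)]; first by exists psi.
rewrite predeqE => x /=; rewrite psiP /=.
have EG z : join_val (join_val (e \o sval x) id) z \o fG =
    join_val (join_val (join_val (e \o sval k) (e \o sval x)) z) e.
  by apply/funext => -[[[]|]|].
have Ephi z : join_val (join_val (e \o sval x) id) z \o fphi = join_val z id.
  by apply/funext => -[].
split=> [h|[z]].
  by exists (e \o sval (k * x)); rewrite !sat_rename EG Ephi GamC.
by rewrite !sat_rename EG Ephi GamC => -[->].
Qed.

Definition ext_type_flow : flow (dg_elt G) :=
  stone_flow (B := ext_definable_algebra) ext_definable_translate.

End ExtDefinableAlgebra.

(* Main.v *)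
Require Import Defs.
From mathcomp Require Import all_boot all_classical.
From mathcomp Require Import topology function_spaces subtype_topology.

(** Let [N] be the chosen minimal left ideal of the enveloping semigroup, [Aut]
the group of automorphisms of the flow [N], and call an automorphism near the
identity if the tau-topology does not separate it from [1].  These
automorphisms form a normal subgroup [H] ([near_id]); if [p] and [q] are not
separated then [p^-1 * q] is in [H], so the claim is that [H] is trivial.

What NIP gives.  For an externally definable [S] and a point [xi] of [Y], the
set [D] of all [n] with [S] in [n xi] is clopen in [N]; these sets separate
points, and no sequence of translates of [D] is independent on [N]
([ellis_nip_separated]): an independent sequence would be visible on finite
sets of group elements, hence, in an ultrapower of [C], witness IP.  An
independent sequence is also what one builds, by repeatedly splitting open
sets, unless every open set contains finitely many open pieces such that each
[g] in [G] leaves [D] constant along one of them ([unsplit_pieces]).  This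
uniform form of fragmentedness replaces the Baire category and convergence
arguments available when the flow is metrizable.

What nonseparation gives.  Fix a point [u] whose [Aut]-orbit is recurrent and
finitely many sets [D] as above; [y] and [z] agree on an open set [B] when
[p y] and [p z] have the same type for all [p] with [p u] in [B].  If [b] is in
[H], there are [h] in [Aut] that move some point very little and some other
point as [b] does.  Left multiplication by [u] carries the first property to
the orbit of [u], and minimality of [N] then gives a [g] in [G] under which the
pieces of the previous paragraph would all be split, unless [y] and [b y] agree
on one of them.  So every open set [W] meeting the orbit of [u] contains finitely
many pieces such that any two points of an [H]-orbit agree on one of them
([unsplit_agree]).

Suppose that some [b0 <> 1] is in [H]; it moves every point, and finitely many
[D] see this.  Then no pair [O], [B] of open sets is rigid, in the sense that
any two points of [O] in one [H]-orbit agree on [B] ([no_rigid_pair]):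
otherwise finitely many translates of [O] cover the [H]-orbit of some [y], so
on a smaller [B'] all points of this orbit agree, whereas [y] and
[p^-1 (b0 (p y))] do not when [p u] is in [B'].  But if no pair is rigid, then
for any pieces [B_1], ..., [B_m] one finds, by induction on [m], finitely many
points of one [H]-orbit such that each point of [N] disagrees with one of them
on all the [B_j] ([exists_shattering]).  This contradicts [unsplit_agree]. *)

Set Implicit Arguments.
Unset Strict Implicit.
Unset Printing Implicit Defensive.

Local Open Scope classical_set_scope.
Local Open Scope group_scope.

(** * Compact spaces *)

Section CompactSpaces.
Variable X : topologicalType.
Hypothesis X_compact : compact [set: X].

Lemma compact_finite_cover (I : choiceType) (F : I -> set X) :
    (forall i, open (F i)) -> (forall x, exists i, F i x) ->
  exists s : seq I, forall x, exists2 i, i \in s & F i x.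
Proof.
move=> oF Fcov; apply: contrapT => nofin.
pose B (s : seq I) := [set x | forall i, i \in s -> ~ F i x].
have B0 s : B s !=set0.
  apply: contrapT => Bs0; apply: nofin; exists s => x.
  apply: contrapT => xB; apply: Bs0; exists x => i si Fi.
  by apply: xB; exists i.
have FF : ProperFilter (filter_from [set: seq I] B).
  apply: filter_from_proper => //; apply: filter_from_filter; first by exists [::].
  move=> s t _ _; exists (s ++ t) => // x Bx.
  by split=> i si; apply: Bx; rewrite mem_cat si ?orbT.
have [|x [_ clx]] := X_compact FF; first by exists [::].
have [i Fi] := Fcov x.
have [] := clx (B [:: i]) (F i); first by exists [:: i].
  by apply: open_nbhs_nbhs; split.
by move=> y [/(_ i)]; rewrite mem_head => /(_ isT).
Qed.

Lemma open_seq_forall (I : eqType) (s : seq I) (F : I -> set X) :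
  (forall i, i \in s -> open (F i)) ->
  open [set x | forall i, i \in s -> F i x].
Proof.
elim: s => [_|i s IH oF].
  rewrite (_ : [set x | _] = setT) ?predeqE; first exact: openT.
  by move=> x; split=> // _ i; rewrite in_nil.
rewrite (_ : [set x | _] = F i `&` [set x | forall j, j \in s -> F j x]).
  apply: openI; first by apply: oF; rewrite mem_head.
  by apply: IH => j sj; apply: oF; rewrite in_cons sj orbT.
rewrite predeqE => x; split=> [Fx|[Fi Fx] j].
  by split=> [|j sj]; apply: Fx; rewrite in_cons ?eqxx // sj orbT.
by rewrite in_cons => /orP[/eqP->//|]; exact: Fx.
Qed.

(** No Baire category is involved, since the cover is finite: either the first
closed set contains the open set, or the others cover an open part of it. *)
Lemma closed_cover_interior (I : eqType) (s : seq I) (F : I -> set X)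
    (O : set X) : (forall i, open (~` F i)) -> open O -> O !=set0 ->
    (forall x, O x -> exists2 i, i \in s & F i x) ->
  exists i U, [/\ i \in s, open U, U !=set0, U `<=` O & U `<=` F i].
Proof.
move=> oF; elim: s O => [|i s IH] O oO [x Ox] cov; first by have [] := cov x Ox.
have [[y [Oy nFy]]|nex] := pselect (exists y, O y /\ ~ F i y).
  have [||z [Oz nFz]|j [U [js oU U0 UO UF]]] := IH (O `&` ~` F i).
  - exact: openI.
  - by exists y.
  - have [j] := cov z Oz.
    by rewrite in_cons => /orP[/eqP->//|js]; exists j.
  exists j, U; split=> //; first by rewrite in_cons js orbT.
  by move=> z /UO[].
exists i, O; split=> //; [exact: mem_head|by exists x|].
by move=> y Oy; apply: contrapT => ny; apply: nex; exists y.
Qed.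

(** Zorn's lemma in the form common to minimal closed subsemigroups and minimal
closed sets for a group of automorphisms: [P] is only required to pass to
intersections. *)
Lemma exists_minimal_closed (P : set (set X)) : [set: X] !=set0 ->
    (forall C : set (set X), C `<=` P -> P (\bigcap_(A in C) A)) ->
  exists M, [/\ closed M, M !=set0, P M &
    forall M', closed M' -> M' !=set0 -> P M' -> M' `<=` M -> M `<=` M'].
Proof.
move=> X0 PI.
pose T := {A : set X | [/\ closed A, A !=set0 & P A]}.
pose R (A B : T) : bool := `[< sval B `<=` sval A >].
have TT : [/\ closed [set: X], [set: X] !=set0 & P setT].
  split=> //.
  by have := PI set0; rewrite bigcap_set0; apply; exact: sub0set.
have [||||[M [cM M0 PM]] Mmax] := @Zorn T R.
- by move=> A; apply/asboolP.
- by move=> A B C /asboolP AB /asboolP BC; apply/asboolP; exact: subset_trans AB.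
- move=> [A pA] [B pB] /asboolP/= BA /asboolP/= AB.
  have E : A = B by apply/seteqP.
  by subst B; congr exist; exact: Prop_irrelevance.
- move=> C Ctot.
  pose D := \bigcap_(A in C) sval A.
  have DE : D = \bigcap_(A in [set sval A | A in C]) A.
    by rewrite bigcap_image.
  have D0 : D !=set0.
    apply: contrapT => Dempty.
    have oC (A : T) : open (if `[< C A >] then ~` sval A else set0).
      case: asboolP => _; last exact: open0.
      by rewrite openC; case: (svalP A).
    have [|s sP] := compact_finite_cover (I := {classic T}) oC.
      move=> x; apply: contrapT => xC; apply: Dempty; exists x => A CA.
      apply: contrapT => nA; apply: xC; exists A.
      by case: asboolP.
    have [x0 _] := X0.
    have [A0 _ ] := sP x0; case: asboolP => // CA0 _.
    have [A [CA Amin]] : exists A, C A /\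
        forall B : {classic T}, B \in s -> C B -> sval A `<=` sval B.
      elim: s {sP} => [|B s [A [CA Amin]]].
        by exists A0; split=> // B; rewrite in_nil.
      have [CB|nCB] := pselect (C B); last first.
        exists A; split=> // B'; rewrite in_cons => /orP[/eqP->//|]; exact: Amin.
      case: (Ctot A B CA CB) => /asboolP AB.
        exists B; split=> // B'; rewrite in_cons => /orP[/eqP-> _|sB' CB'].
          exact: subset_refl.
        by apply: (subset_trans AB); exact: Amin.
      exists A; split=> // B'; rewrite in_cons => /orP[/eqP-> _|]; last exact: Amin.
      exact: AB.
    case: (svalP A) => _ [a Aa] _; have [B sB] := sP a.
    by case: asboolP => // CB; apply; exact: Amin Aa.
  have pD : [/\ closed D, D !=set0 & P D].
    split=> //; first by apply: closed_bigI => A _; case: (svalP A).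
    by rewrite DE; apply: PI => _ [A _ <-]; case: (svalP A).
  by exists (exist _ D pD) => A CA; apply/asboolP => x; apply.
exists M; split=> // M' cM' M'0 PM' M'M.
have pM' : [/\ closed M', M' !=set0 & P M'] by [].
have := Mmax (exist _ M' pM'); rewrite /R /= => h.
by have /(congr1 sval)/= -> := h (asboolT M'M).
Qed.

End CompactSpaces.


(** * Clopen sets without independent translates *)

Section NipSets.
Variables (G : groupType) (N : flow G).

Definition independent_translates (D : set N) (g : nat -> G) : Prop :=
  forall (n : nat) (I : set nat), exists x : N,
    forall k, (k < n)%N -> (D (fact (g k) x) <-> I k).

(** Being closed under preimages by automorphisms of the flow, this class is
more convenient than that of the basic sets given by a formula and a type. *)
Definition nip_clopen : set (set N) := [set D |
  [/\ open D, open (~` D) & ~ exists g, independent_translates D g]].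

Definition same_type (ds : seq (set N)) (x y : N) : Prop :=
  forall D, D \in ds -> (D x <-> D y).

Definition nip_list (ds : seq (set N)) : Prop :=
  forall D, D \in ds -> nip_clopen D.

Lemma same_type_sym ds x y : same_type ds x y -> same_type ds y x.
Proof. by move=> xy D Dds; rewrite xy. Qed.

Lemma same_type_trans ds x y z :
  same_type ds x y -> same_type ds y z -> same_type ds x z.
Proof. by move=> xy yz D Dds; rewrite xy // yz. Qed.

Lemma not_same_type ds x y : ~ same_type ds x y ->
  exists2 D, D \in ds & ~ (D x <-> D y).
Proof.
move=> nxy; apply: contrapT => h; apply: nxy => D Dds.
by apply: contrapT => nD; apply: h; exists D.
Qed.

Lemma open_same_type ds x : nip_list ds -> open [set y | same_type ds y x].
Proof.
move=> dsN; apply: open_seq_forall => D /dsN[oD oDC _].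
have [Dx|nDx] := pselect (D x).
  by rewrite (_ : (fun _ => _) = D) // predeqE => y; split=> [->|].
rewrite (_ : (fun _ => _) = ~` D) // predeqE => y; split=> [yx /yx//|nDy].
by split.
Qed.

Definition splits (T : set N) (ds : seq (set N)) (g : G) (B : set N) : Prop :=
  exists x y, [/\ T x /\ B x, T y /\ B y &
    ~ same_type ds (fact g x) (fact g y)].

Definition pieces (T W : set N) (L : seq (set N)) : Prop :=
  forall B, B \in L -> [/\ open B, B `<=` W & exists2 x, T x & B x].

Lemma open_fact (g : G) (A : set N) : open A -> open [set x | A (fact g x)].
Proof. by move/continuousP: (@fact_continuous _ N g); apply. Qed.

(** If every finite family of pieces could be split by one element of [G],
then iterating the splitting from [W] would produce a binary tree of pieces,
whose levels show that the chosen elements give independent translates. *)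
Lemma unsplit_pieces1 T D W : nip_clopen D -> open W -> (exists2 x, T x & W x) ->
  exists2 L, pieces T W L & forall g, exists2 B, B \in L & ~ splits T [:: D] g B.
Proof.
move=> [oD oDC nind] oW TW; apply: contrapT => noL; apply: nind.
have split_all L : pieces T W L -> exists g, forall B, B \in L -> splits T [:: D] g B.
  move=> LW; apply: contrapT => nog; apply: noL; exists L => // g.
  apply: contrapT => noB; apply: nog; exists g => B BL.
  by apply: contrapT => nB; apply: noB; exists B.
pose splitters (L : seq (set N)) :=
  [set g : G | forall B, B \in L -> splits T [:: D] g B].
pose pick (L : seq (set N)) : G := xget 1 (splitters L).
pose refine (L : seq (set N)) : seq (set N) :=
  [seq B `&` [set x | D (fact (pick L) x)] | B <- L] ++
  [seq B `&` [set x | ~ D (fact (pick L) x)] | B <- L].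
have split_pick L : pieces T W L -> forall B, B \in L ->
    (exists2 x, T x & B x /\ D (fact (pick L) x)) /\
    (exists2 x, T x & B x /\ ~ D (fact (pick L) x)).
  move=> LW; have [g gL] := split_all L LW; move=> B BL.
  have [x [y [[Tx Bx] [Ty By] /not_same_type[D']]]] : splits T [:: D] (pick L) B.
    by apply: (@xgetPex G 1 (splitters L)) => //; exists g.
  rewrite mem_seq1 => /eqP -> ndxy.
  have [Dx|nDx] := pselect (D (fact (pick L) x)).
    by split; [exists x|exists y => //; split=> // Dy; apply: ndxy].
  split; last by exists x.
  by exists y => //; split=> //; apply: contrapT => nDy; apply: ndxy.
have refineW L : pieces T W L -> pieces T W (refine L).
  move=> LW B; rewrite mem_cat => /orP[] /mapP[B' B'L ->].
    have [oB' B'W _] := LW _ B'L; have [[x Tx Bx] _] := split_pick _ LW _ B'L.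
    split; [|by apply: subset_trans B'W; exact: subIsetl|by exists x].
    by apply: openI => //; exact: open_fact oD.
  have [oB' B'W _] := LW _ B'L; have [_ [x Tx Bx]] := split_pick _ LW _ B'L.
  split; [|by apply: subset_trans B'W; exact: subIsetl|by exists x].
  by apply: openI => //; exact: open_fact oDC.
pose Ls n := iter n refine [:: W].
have LsW n : pieces T W (Ls n).
  elim: n => [|n IH]; last exact: refineW.
  by move=> B; rewrite mem_seq1 => /eqP->; split.
exists (pick \o Ls) => n I.
suff [B BL BI] : exists2 B, B \in Ls n & forall x, B x ->
    forall k, (k < n)%N -> (D (fact (pick (Ls k)) x) <-> I k).
  by have [_ _ [x _ Bx]] := LsW _ _ BL; exists x => k kn; exact: BI.
elim: n => [|n [B BL BI]]; first by exists W; rewrite ?mem_head.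
have [In|nIn] := pselect (I n).
  exists (B `&` [set x | D (fact (pick (Ls n)) x)]).
    by rewrite mem_cat; apply/orP; left; apply/mapP; exists B.
  move=> x [Bx Dx] k; rewrite ltnS leq_eqVlt => /orP[/eqP->|]; [by split|exact: BI].
exists (B `&` [set x | ~ D (fact (pick (Ls n)) x)]).
  by rewrite mem_cat; apply/orP; right; apply/mapP; exists B.
move=> x [Bx Dx] k; rewrite ltnS leq_eqVlt => /orP[/eqP->|]; [by split|exact: BI].
Qed.

(** For several sets, families are nested: inside each piece that is unsplit for
the first set one takes pieces that are unsplit for the remaining ones.  An
element that splits all of the latter splits, for the first set, some
subpiece of every piece of the first family. *)
Lemma unsplit_pieces T ds W : nip_list ds -> open W -> (exists2 x, T x & W x) ->
  exists2 L, pieces T W L & forall g, exists2 B, B \in L & ~ splits T ds g B.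
Proof.
elim: ds W => [|D ds IH] W dsN oW TW.
  exists [:: W]; first by move=> B; rewrite mem_seq1 => /eqP->; split.
  move=> g; exists W; rewrite ?mem_head // => -[x [y [_ _]]].
  by apply=> D; rewrite in_nil.
have [L LW Lg] := unsplit_pieces1 (dsN D (mem_head _ _)) oW TW.
have ds'N : nip_list ds by move=> D' D'ds; apply: dsN; rewrite in_cons D'ds orbT.
have sub B : exists L', B \in L -> pieces T B L' /\
    forall g, exists2 B', B' \in L' & ~ splits T ds g B'.
  have [BL|nBL] := pselect (B \in L); last by exists [::].
  have [oB _ TB] := LW _ BL.
  by have [L' L'B L'g] := IH B ds'N oB TB; exists L' => _; split; [exact: L'B|exact: L'g].
have [F FP] := choice sub.
exists (flatten [seq F B | B <- L]).
  move=> B' /flattenP[_ /mapP[B BL ->]] B'F.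
  have [/(_ _ B'F)[oB' B'B TB'] _] := FP B BL; have [_ BW _] := LW _ BL.
  by split=> //; exact: subset_trans BW.
move=> g; have [B BL nsplit] := Lg g.
have [FB /(_ g)[B' B'F nsplit']] := FP B BL.
exists B'; first by apply/flattenP; exists (F B) => //; exact: map_f.
have [_ B'B _] := FB _ B'F.
move=> [x [y [[Tx Bx] [Ty By] /not_same_type[D']]]].
rewrite in_cons => /orP[/eqP->|D'ds] nxy.
  apply: nsplit; exists x, y; split; [by split=> //; exact: B'B..|].
  by move=> /(_ D); rewrite mem_head => /(_ isT).
by apply: nsplit'; exists x, y; split=> // /(_ D' D'ds).
Qed.

End NipSets.

(** * Automorphisms near the identity *)

Section Automorphisms.
Variables (G : groupType) (N : flow G).

Lemma autVK (p : aut N) : cancel p (p^-1%g : aut N).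
Proof. exact: (aut_invK p).1. Qed.

Lemma autKV (p : aut N) : cancel (p^-1%g : aut N) p.
Proof. exact: (aut_invK p).2. Qed.

Lemma open_aut (p : aut N) (A : set N) : open A -> open [set x | A (p x)].
Proof. by move/continuousP: (@aut_continuous _ _ p); apply. Qed.

Lemma nip_clopen_aut (p : aut N) (D : set N) :
  nip_clopen D -> nip_clopen [set x | D (p x)].
Proof.
move=> [oD oDC nind]; split; [exact: open_aut|exact: open_aut oDC|].
move=> [g gI]; apply: nind; exists g => n I; have [x xI] := gI n I.
by exists (p x) => k kn; rewrite -aut_equivariant; exact: xI.
Qed.

(** Points of minimal [H]-invariant closed sets, characterized without their
orbit closure so that recurrence is visibly invariant under [G]. *)
Definition recurrent (H : set (aut N)) (z : N) : Prop :=
  forall V : set N, open V -> V z -> exists2 ts : seq (aut N),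
    (forall t, t \in ts -> H t) &
    forall s, H s -> exists2 t, t \in ts & V (t (s z)).

Lemma recurrent_fact (H : set (aut N)) g z :
  recurrent H z -> recurrent H (fact g z).
Proof.
move=> zrec V oV Vgz.
have [ts tsH tsP] := zrec _ (open_fact g oV) Vgz.
exists ts => // s /tsP[t tts Vt]; exists t => //.
by rewrite !aut_equivariant.
Qed.

Lemma exists_recurrent (H : set (aut N)) : [set: N] !=set0 -> H 1 ->
  (forall s t, H s -> H t -> H (s * t)) -> exists z, recurrent H z.
Proof.
move=> N0 H1 HM; have cN := @fspace_compact _ N.
pose P := [set A : set N | forall t x, H t -> A x -> A (t x)].
have [|M [cM [z Mz] PM Mmin]] := exists_minimal_closed cN (P := P) N0.
  by move=> C CP t x Ht Cx A CA; apply: CP => //; exact: Cx.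
exists z => V oV Vz.
have cov x : exists t : aut N,
    if `[< H t >] then (~` M `|` [set y | V (t y)]) x else False.
  have [Mx|nMx] := pselect (M x); last first.
    by exists 1; case: asboolP => // _; left.
  apply: contrapT => nt.
  pose M' := M `&` [set y | forall t, H t -> ~ V (t y)].
  suff /(_ z Mz)[_ /(_ 1 H1)] : M `<=` M' by [].
  apply: Mmin.
  - apply: closedI => //; rewrite (_ : [set y | _] =
        \bigcap_(t in H) ~` [set y | V (t y)]); last first.
      by rewrite predeqE.
    by apply: closed_bigI => t _; rewrite closedC; exact: open_aut.
  - exists x; split=> // t Ht Vt; apply: nt; exists t.
    by case: asboolP => // _; right.
  - move=> t y Ht [My nVy]; split; first exact: PM.
    by move=> s Hs; have := nVy (s * t) (HM _ _ Hs Ht).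
  - exact: subIsetl.
have [||ts tsP] := @compact_finite_cover _ cN _
    (fun t : aut N => if `[< H t >] then ~` M `|` [set y | V (t y)] else set0).
- move=> t; case: asboolP => _; last exact: open0.
  by apply: openU; [rewrite openC|exact: open_aut].
- by move=> x; have [t] := cov x; exists t; case: asboolP p.
exists [seq t <- ts | `[< H t >]].
  by move=> t; rewrite mem_filter => /andP[/asboolP].
move=> s Hs; have [t tts] := tsP (s z).
case: asboolP => // Ht [nM|Vt]; first by case: nM; exact: PM.
by exists t => //; rewrite mem_filter tts andbT; exact/asboolP.
Qed.

(** Nonseparation from the identity in the tau-topology, spelled out with the
basic tau-open sets of all [h] whose graph meets a given open rectangle. *)
Definition near_id : set (aut N) := [set b | forall Q V1 V2 : set N,
  open Q -> Q !=set0 -> open V1 -> open V2 -> (exists y, V1 y /\ V2 (b y)) ->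
  exists h : aut N, (exists x, Q x /\ Q (h x)) /\ (exists y, V1 y /\ V2 (h y))].

Lemma near_id1 : near_id 1.
Proof.
by move=> Q V1 V2 oQ [x Qx] oV1 oV2 [y Vy]; exists 1; split; [exists x|exists y].
Qed.

(** The relation of not being separated need not be transitive; what helps is
that an [h] that moves some point of [Q] within [Q] still has a whole
neighbourhood of composites [h * k] with this property, for [k] close enough
to the identity. *)
Lemma near_idM b c : near_id b -> near_id c -> near_id (b * c).
Proof.
move=> Hb Hc Q V1 V2 oQ Q0 oV1 oV2 [y [V1y V2y]].
have [||h [[x [Qx Qhx]] [z [V1z V2z]]]] :=
    Hb Q [set x | V1 ((c^-1%g : aut N) x)] V2 oQ Q0 _ oV2.
- exact: open_aut.
- by exists (c y); rewrite /= autVK.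
have [|||||k [[x' [[Qx' Qhx'] [Qkx' Qhkx']]] [z' [V1z' V2z']]]] :=
    Hc (Q `&` [set x | Q (h x)]) V1 [set x | V2 (h x)].
- by apply: openI => //; exact: open_aut.
- by exists x.
- by [].
- exact: open_aut.
- by exists ((c^-1%g : aut N) z); split=> //=; rewrite autKV.
by exists (h * k); split; [exists x'|exists z'].
Qed.

Lemma near_idV b : near_id b -> near_id b^-1.
Proof.
move=> Hb Q V1 V2 oQ Q0 oV1 oV2 [y [V1y V2y]].
have [|h [[x [Qx Qhx]] [z [V2z V1z]]]] := Hb Q V2 V1 oQ Q0 oV2 oV1.
  by exists ((b^-1%g : aut N) y); rewrite autKV.
exists h^-1; split; first by exists (h x); rewrite autVK.
by exists (h z); rewrite autVK.
Qed.

Lemma near_idJ b p : near_id b -> near_id (p^-1 * b * p).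
Proof.
move=> Hb Q V1 V2 oQ [x Qx] oV1 oV2 [y [V1y V2y]].
pose m (A : set N) := [set x | A ((p^-1%g : aut N) x)].
have om A : open A -> open (m A) by exact: open_aut.
have [||h [[x' [Qx' Qhx']] [z [V1z V2z]]]] :=
  Hb (m Q) (m V1) (m V2) (om _ oQ) _ (om _ oV1) (om _ oV2).
- by exists (p x); rewrite /m /= autVK.
- by exists (p y); split; rewrite /m /= ?autVK.
exists (p^-1 * h * p); split.
  by exists ((p^-1%g : aut N) x'); split=> //=; rewrite autKV.
by exists ((p^-1%g : aut N) z); split=> //=; rewrite autKV.
Qed.

End Automorphisms.

(** * Minimal flows separated by NIP sets *)

Section TameMinimalFlow.
Variables (G : groupType) (N : flow G).
Hypothesis minN : minimal N.
Hypothesis nip_separated :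
  forall x y : N, x <> y -> exists D, [/\ nip_clopen D, D x & ~ D y].

Lemma open_same_type_aut ds (p : aut N) z :
  nip_list ds -> open [set x | same_type ds (p x) z].
Proof. by move=> dsN; exact: (open_aut p (open_same_type z dsN)). Qed.

(** By compactness the separating sets generate the topology. *)
Lemma nip_cell (x : N) (V : set N) : open V -> V x ->
  exists2 ds, nip_list ds & forall y, same_type ds y x -> V y.
Proof.
move=> oV Vx.
have sep y : exists D, ~ V y -> [/\ nip_clopen D, D y & ~ D x].
  have [Vy|nVy] := pselect (V y); first by exists setT.
  have [|D [? ? ?]] := nip_separated (x := y) (y := x).
    by move=> yx; rewrite yx in nVy.
  by exists D.
have [D DP] := choice sep.
have [||s sP] := @compact_finite_cover _ (@fspace_compact _ N) _
    (fun y => if `[< V y >] then V else D y).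
- by move=> y; case: asboolP => // /DP[[]].
- by move=> y; exists y; case: asboolP => // /DP[].
exists [seq D y | y <- s & ~~ `[< V y >]].
  by move=> _ /mapP[y + ->]; rewrite mem_filter => /andP[/asboolPn/DP[]].
move=> y yx; have [z zs] := sP y; case: asboolP => // nVz Dy.
have [_ _ nDx] := DP z nVz; case: nDx; apply/(yx (D z)) => //.
by apply: map_f; rewrite mem_filter zs andbT; exact/asboolPn.
Qed.

Lemma dense_fact (x : N) (V : set N) :
  open V -> V !=set0 -> exists g : G, V (fact g x).
Proof.
move=> oV V0; have [y [Vy [g _ gy]]] := minN.2 x V V0 oV.
by exists g; rewrite gy.
Qed.

Variable u : N.
Hypothesis u_recurrent : recurrent setT u.
(** In the application [lam] is left multiplication by [u] in the Ellis
semigroup: a pointwise limit of elements of [G], in general discontinuous, that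
maps [N] into the orbit of [u] under automorphisms. *)
Variable lam : N -> N.
Hypothesis lam_orbit : forall x, exists p : aut N, lam x = p u.
Hypothesis lam_approx : forall (xs : seq N) ds, nip_list ds ->
  exists g : G, forall x, x \in xs -> same_type ds (fact g x) (lam x).

Definition orb : set N := range (fun p : aut N => p u).

(** In terms of the Ellis semigroup, [y] and [z] agree on [B] when left
multiplications by [y] and by [z] have the same type on the part of the orbit
of [u] that lies in [B]. *)
Definition agree (ds : seq (set N)) (B : set N) (y z : N) : Prop :=
  forall p : aut N, B (p u) -> same_type ds (p y) (p z).

Lemma agree_sym ds B y z : agree ds B y z -> agree ds B z y.
Proof. by move=> yz p Bp; apply: same_type_sym; exact: yz. Qed.

Lemma agree_trans ds B x y z :
  agree ds B x y -> agree ds B y z -> agree ds B x z.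
Proof. by move=> xy yz p Bp; apply: same_type_trans (xy p Bp) (yz p Bp). Qed.

Lemma agreeS ds B B' y z : B' `<=` B -> agree ds B y z -> agree ds B' y z.
Proof. by move=> B'B yz p /B'B; exact: yz. Qed.

Lemma lam_equivariant (p : aut N) x : lam (p x) = p (lam x).
Proof.
apply: contrapT => /nip_separated[D [DN Dx nDx]].
have [|g gP] := @lam_approx [:: p x; x] [:: D; [set y | D (p y)]].
  by move=> D'; rewrite !inE => /orP[]/eqP->//; exact: nip_clopen_aut.
have h1 := gP (p x) (mem_head _ _) D (mem_head _ _).
have /= h2 := gP x _ [set y | D (p y)] _.
apply: nDx; apply/h2; rewrite ?inE ?eqxx ?orbT //.
by rewrite aut_equivariant; apply/h1.
Qed.

(** Although [lam] need not be continuous, it maps some nonempty open set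
into [V].  By recurrence finitely many translates of [V] cover the orbit of
[u], and on some open set the type of [lam] relative to all the translates is
constant: if [lam] varied on all pieces of an unsplit family, then so would an
element of [G] close to [lam] at two points of each piece.  An automorphism then
moves that open set so that its image lies in [V] itself. *)
Lemma lam_interior (V : set N) : open V -> V u ->
  exists Q, [/\ open Q, Q !=set0 & forall x, Q x -> V (lam x)].
Proof.
move=> oV Vu; have [ds dsN dsV] := nip_cell oV Vu.
have [ts _ tsP] := u_recurrent (open_same_type u dsN) (fun D _ => iff_refl _).
pose ds' := [seq [set x | D ((t : aut N) x)] | t <- ts, D <- ds].
have ds'N : nip_list ds'.
  by move=> _ /allpairsP[[t D] [/= _ /dsN ? ->]]; exact: nip_clopen_aut.
have [x0 _] := minN.1.
have [|L LT Lg] := @unsplit_pieces _ N setT ds' setT ds'N openT; first by exists x0.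
have [B BL Bconst] : exists2 B, B \in L &
    forall x y, B x -> B y -> same_type ds' (lam x) (lam y).
  apply: contrapT => noB.
  have pairs B : exists xy : N * N, B \in L ->
      [/\ B xy.1, B xy.2 & ~ same_type ds' (lam xy.1) (lam xy.2)].
    apply: contrapT => noxy; apply: noB; exists B.
      by apply: contrapT => nBL; apply: noxy; exists (x0, x0).
    move=> x y Bx By; apply: contrapT => nxy; apply: noxy.
    by exists (x, y).
  have [f fP] := choice pairs.
  have [g gP] := @lam_approx ([seq (f B).1 | B <- L] ++ [seq (f B).2 | B <- L])
    ds' ds'N.
  have [B BL] := Lg g; apply; have [B1 B2 nB] := fP B BL.
  exists (f B).1, (f B).2; split=> // gtype; apply: nB.
  have g1 : same_type ds' (lam (f B).1) (fact g (f B).1).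
    by apply: same_type_sym; apply: gP; rewrite mem_cat (map_f (fun B => (f B).1)).
  have g2 : same_type ds' (fact g (f B).2) (lam (f B).2).
    by apply: gP; rewrite mem_cat (map_f (fun B => (f B).2)) ?orbT.
  exact: same_type_trans g1 (same_type_trans gtype g2).
have [oB _ [y0 _ By0]] := LT B BL.
have [p0 p0E] := lam_orbit y0.
have [t tts tP] := tsP p0 I.
exists [set x | B ((t^-1%g : aut N) x)]; split; first exact: open_aut.
  by exists (t y0); rewrite /= autVK.
move=> x Bx; apply: dsV; apply: same_type_trans tP; rewrite -p0E.
rewrite -(autKV t x) lam_equivariant => D Dds.
have := Bconst _ _ Bx By0 [set x | D (t x)]; apply.
by apply/allpairsP; exists (t, D).
Qed.

(** Suppose that [y] and [b y] disagree on all unsplit pieces [B], at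
automorphisms [p B].  On some open [Q] the map [lam] takes values so close to
[u] that [p B] sends them into [B].  Choose [h] moving a point [x] of [Q]
within [Q] and acting somewhere as [b] does at [y].  Then [r = lam x] and
[h r = lam (h x)] are both sent into [B] by [p B], while some [g] moves [r]
close enough to a point where [h] looks like [b] at [y] that [p B (g r)] and
[p B (g (h r))] have the types of [p B y] and [p B (b y)].  So [g] splits every
[B]. *)
Lemma unsplit_agree ds W : nip_list ds -> open W -> (exists p : aut N, W (p u)) ->
  exists2 L, pieces orb W L &
    forall y b, near_id b -> exists2 B, B \in L & agree ds B y ((b : aut N) y).
Proof.
move=> dsN oW [p0 Wp0].
have [|L LW Lg] := @unsplit_pieces _ N orb ds W dsN oW.
  by exists (p0 u) => //; exists p0.
exists L => // y b Hb; apply: contrapT => nagree.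
have bad B : exists p : aut N, B \in L -> B (p u) /\ ~ same_type ds (p y) (p (b y)).
  apply: contrapT => nop; apply: nagree; exists B.
    by apply: contrapT => nBL; apply: nop; exists 1.
  move=> p Bp; apply: contrapT => np; apply: nop; exists p => _; by split.
have [p pP] := choice bad.
have [||Q [oQ Q0 QV]] := @lam_interior [set x | forall B, B \in L -> B (p B x)].
- apply: open_seq_forall => B BL; apply: open_aut; by have [] := LW B BL.
- by move=> B BL; have [] := pP B BL.
pose V z := [set x | forall B, B \in L -> same_type ds (p B x) (p B z)].
have oV z : open (V z).
  by apply: open_seq_forall => B BL; exact: open_same_type_aut.
have [|h [[x [Qx Qhx]] [z [Vz Vhz]]]] := Hb Q (V y) (V (b y)) oQ Q0 (oV _) (oV _).
  by exists y; split=> B BL D _.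
have [||g [Vg Vhg]] := @dense_fact (lam x) (V y `&` [set z | V (b y) (h z)]).
- by apply: openI => //; exact: open_aut.
- by exists z.
have [B BL] := Lg g; apply.
have [r rE] := lam_orbit x.
exists (p B (lam x)), (p B (h (lam x))); split.
- by split; [exists (p B * r) => //=; rewrite rE|exact: (QV x Qx B BL)].
- split; first by exists (p B * (h * r)) => //=; rewrite rE.
  by rewrite -lam_equivariant; exact: (QV _ Qhx B BL).
rewrite -!aut_equivariant => gtype; have [_] := pP B BL; apply.
apply: same_type_trans (same_type_trans (same_type_sym (Vg B BL)) gtype) _.
by have := Vhg B BL; rewrite aut_equivariant.
Qed.

Lemma shrink_agree ds W (zs : seq (N * aut N)) : nip_list ds -> open W ->
    (exists p : aut N, W (p u)) -> (forall z, z \in zs -> near_id z.2) ->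
  exists B, [/\ open B, B `<=` W, exists p : aut N, B (p u) &
    forall z, z \in zs -> agree ds B z.1 ((z.2 : aut N) z.1)].
Proof.
move=> dsN oW Wp; elim: zs => [_|[y b] zs IH zsH].
  by exists W; split=> // z; rewrite in_nil.
have [z zzs|B [oB BW Bp Bzs]] := IH; first by apply: zsH; rewrite in_cons zzs orbT.
have [L LB Lagree] := unsplit_agree dsN oB Bp.
have [B' B'L B'y] := Lagree y b (zsH (y, b) (mem_head _ _)).
have [oB' B'B [_ [p _ <-] B'p]] := LB B' B'L.
exists B'; split=> //; [exact: subset_trans BW|by exists p|].
move=> z; rewrite in_cons => /orP[/eqP->//|zzs].
exact: agreeS B'B (Bzs z zzs).
Qed.

Section NearIdentity.
Variable b0 : aut N.
Hypothesis b0_near : near_id b0.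
Variable ds : seq (set N).
Hypothesis ds_nip : nip_list ds.
Hypothesis ds_b0 : forall x, ~ same_type ds x (b0 x).

(** The proof assumes a rigid pair [O], [B].  A point [z] of [O] recurrent under
[near_id] returns to [O], from anywhere in its orbit, by one of finitely many
[t].  Shrinking [B] to [C], where [p u] in [C] forces [p (t^-1 u)] in [B],
turns rigidity into finitely many classes of the orbit for agreement on [C];
shrinking again to [E] merges these classes.  A conjugate of [b0] then
contradicts [ds_b0]. *)
Lemma no_rigid_pair (O B : set N) : open O -> O !=set0 ->
    open B -> (exists p : aut N, B (p u)) ->
  exists y b, [/\ near_id b, O y, O ((b : aut N) y) & ~ agree ds B y (b y)].
Proof.
move=> oO O0 oB [p0 Bp0]; apply: contrapT => rigid.
have {}rigid y b : near_id b -> O y -> O ((b : aut N) y) -> agree ds B y (b y).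
  by move=> Hb Oy Oby; apply: contrapT => nyb; apply: rigid; exists y, b.
have [z0 z0rec] := exists_recurrent minN.1 (@near_id1 _ N) (@near_idM _ N).
have [g Oz] := dense_fact z0 oO O0.
have zrec := recurrent_fact (g := g) z0rec; move: (fact g z0) Oz zrec => z Oz zrec.
have [ts tsH tsP] := zrec O oO Oz.
have [cs csN csB] := nip_cell oB Bp0.
have [|||C [oC CB Cp Cts]] :=
  @shrink_agree cs (B `&` [set x | same_type cs x (p0 u)])
    [seq (u, (t^-1%g : aut N)) | t <- ts] csN.
- by apply: openI => //; exact: open_same_type.
- by exists p0; split=> // D _.
- by move=> _ /mapP[t tts ->]; exact/near_idV/tsH.
(* Types relative to [cs] determine membership in [B] near [p0 u]. *)
have CtB (t p : aut N) : t \in ts -> C (p u) -> B ((p * t^-1%g : aut N) u).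
  move=> tts Cpu; apply: csB; have [_ pu0] := CB _ Cpu.
  apply: same_type_trans pu0; apply: same_type_sym.
  by apply: (Cts (u, (t^-1%g : aut N))) => //; apply/mapP; exists t.
have agree_ts (t s s' : aut N) : t \in ts -> near_id s -> near_id s' ->
    O ((t : aut N) ((s : aut N) z)) -> O (t ((s' : aut N) z)) -> agree ds C (s z) (s' z).
  move=> tts Hs Hs' Os Os' p Cpu.
  have Ht := tsH t tts.
  have Hc : near_id (t * s' * s^-1 * t^-1).
    by apply: near_idM (near_idV Ht); apply: near_idM (near_idV Hs); exact: near_idM.
  have cE : (t * s' * s^-1 * t^-1 : aut N) (t (s z)) = t (s' z) by rewrite /= !autVK.
  have := rigid _ _ Hc Os; rewrite cE => /(_ Os' _ (CtB t p tts Cpu)).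
  by rewrite /= !autVK.
have reps (t : aut N) : exists s : aut N, near_id s /\
    (forall s', near_id s' -> O ((t : aut N) ((s' : aut N) z)) -> O (t (s z))).
  have [[s [Hs Os]]|ns] := pselect (exists s : aut N, near_id s /\ O (t (s z))).
    by exists s.
  exists 1; split; first exact: near_id1.
  by move=> s' Hs' Os'; case: ns; exists s'.
have [f fP] := choice reps.
have [|E [oE EC [p Ep] Ets]] := @shrink_agree ds C [seq (z, f t) | t <- ts] ds_nip oC Cp.
  by move=> _ /mapP[t _ ->]; have [] := fP t.
(* The orbit meets finitely many classes, represented by the [f t z], and on [E]
   these agree with [z]. *)
have HE (s : aut N) : near_id s -> agree ds E ((s : aut N) z) z.
  move=> Hs; have [t tts Os] := tsP s Hs; have [Hf Of] := fP t.
  apply: agree_trans (agreeS EC (agree_ts t s (f t) tts Hs Hf Os (Of s Hs Os))) _.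
  by apply: agree_sym; apply: (Ets (z, f t)); apply/mapP; exists t.
have := HE _ (near_idJ (p := p) b0_near) p Ep.
rewrite [(_ * _ * p)%g z]/= autKV => h; exact: (ds_b0 (same_type_sym h)).
Qed.

(** For each piece, [N] is a finite union of the closed sets of points [y] that
agree with [b y] on a given subpiece, so that one of these sets has interior
in [O]. *)
Lemma agree_locally (b : aut N) (L : seq (set N)) (O : set N) : near_id b ->
    open O -> O !=set0 ->
    (forall B, B \in L -> open B /\ exists p : aut N, B (p u)) ->
  exists O' L', [/\ open O', O' !=set0, O' `<=` O, size L' = size L &
    [/\ forall B', B' \in L' -> open B' /\ exists p : aut N, B' (p u),
     forall B, B \in L -> exists2 B', B' \in L' & B' `<=` B &
     forall B' y, B' \in L' -> O' y -> agree ds B' y (b y)]].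
Proof.
move=> Hb; elim: L O => [|B L IH] O oO O0 LP.
  by exists O, [::]; split=> //; split.
have [B' B'L|O1 [L1 [oO1 O10 O1O szL1 [L1P L1L L1agree]]]] := IH O oO O0.
  by apply: LP; rewrite in_cons B'L orbT.
have [oB Bp] := LP B (mem_head _ _).
have [L2 L2B L2agree] := unsplit_agree ds_nip oB Bp.
have nagree_open B' : open [set y | ~ agree ds B' y (b y)].
  rewrite (_ : [set y | _] = \bigcup_(p in [set p : aut N | B' (p u)])
    [set y | ~ same_type ds (p y) (p (b y))]); last first.
    rewrite predeqE => y; split=> [ny|[p /= B'p np] /(_ p B'p)//].
    apply: contrapT => nc; apply: ny => p B'p; apply: contrapT => np.
    by apply: nc; exists p.
  apply: bigcup_open => p _.
  rewrite openE => y /= nyb.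
  pose Vy : set N := [set x | same_type ds (p x) (p y)] `&`
    [set x | same_type ds (p (b x)) (p (b y))].
  have oVy : open Vy.
    apply: openI; first exact: open_same_type_aut.
    apply: (open_aut b (A := [set x | same_type ds (p x) (p (b y))])).
    exact: open_same_type_aut.
  apply: filterS (open_nbhs_nbhs (conj oVy _)); last by split=> D _.
  move=> x [xy bxy] xb; apply: nyb; apply: same_type_trans (same_type_sym xy) _.
  exact: same_type_trans xb bxy.
have [|B2 [O2 [B2L oO2 O20 O2O O2agree]]] :=
    @closed_cover_interior _ _ L2 (fun B' => [set y | agree ds B' y (b y)]) O1
      nagree_open oO1 O10.
  by move=> y _; exact: L2agree.
have [oB2 B2B [_ [p _ <-] B2p]] := L2B B2 B2L.
exists O2, (B2 :: L1); split=> //; [exact: subset_trans O1O|by rewrite /= szL1|].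
split.
- by move=> B'; rewrite in_cons => /orP[/eqP->|/L1P//]; split=> //; exists p.
- move=> B'; rewrite in_cons => /orP[/eqP->|/L1L[B3 B3L1 B3B']].
    by exists B2; rewrite ?mem_head.
  by exists B3 => //; rewrite in_cons B3L1 orbT.
- move=> B' y; rewrite in_cons => /orP[/eqP->|B'L1] O2y; first exact: O2agree.
  by apply: L1agree => //; exact: O2O.
Qed.

(** Induction on the number of pieces.  A failure of rigidity for the first piece
gives [b] such that [z] and [b z] disagree on it, for all [z] in a smaller open
set, and after shrinking the other pieces [z] and [b z] agree on them.  If [z]
disagrees with [v] on the others, then so does [b z], and one of [z], [b z]
disagrees with [v] on the first piece too. *)
Lemma exists_shattering (L : seq (set N)) (O : set N) : open O -> O !=set0 ->
    (forall B, B \in L -> open B /\ exists p : aut N, B (p u)) ->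
  exists y (A : set N), [/\ A `<=` O,
    forall z, A z -> exists2 b, near_id b & z = (b : aut N) y &
    forall v, exists2 z, A z & forall B, B \in L -> ~ agree ds B z v].
Proof.
move: {2}(size L) (erefl (size L)) => n.
elim: n L O => [|n IH] [|B L] O //= szL oO [x Ox] LP.
  exists x, [set x]; split=> [_ ->//|z ->|v]; last by exists x.
  by exists 1; [exact: near_id1|].
case: szL => szL; have [oB Bp] := LP B (mem_head _ _).
have [|y0 [b [Hb Oy Oby /existsNP[p nagree]]]] := @no_rigid_pair O B oO _ oB Bp.
  by exists x.
have {nagree} [Bpu nyb] : B (p u) /\ ~ same_type ds (p y0) (p (b y0)).
  by split; [apply: contrapT => nB; apply: nagree|move=> h; apply: nagree].
pose O1 := (O `&` [set y | O (b y)]) `&` ([set y | same_type ds (p y) (p y0)] `&`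
    [set y | same_type ds (p (b y)) (p (b y0))]).
have oO1 : open O1.
  apply: openI; apply: openI => //; first exact: open_aut.
    exact: open_same_type_aut.
  apply: (open_aut b (A := [set x | same_type ds (p x) (p (b y0))])).
  exact: open_same_type_aut.
have O10 : O1 !=set0 by exists y0; split; split=> // D _.
have O1nb y : O1 y -> ~ same_type ds (p y) (p (b y)).
  move=> [_ [y1 y2]] yb; apply: nyb.
  exact: same_type_trans (same_type_sym y1) (same_type_trans yb y2).
have [B' B'L|O2 [L2 [oO2 O20 O2O szL2 [L2P L2L L2agree]]]] :=
    @agree_locally b L O1 Hb oO1 O10.
  by apply: LP; rewrite in_cons B'L orbT.
have [y [A [AO Ay Av]]] := IH L2 O2 (etrans szL2 szL) oO2 O20 L2P.
exists y, (A `|` [set b z | z in A]); split.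
- move=> z [/AO/O2O[[]]//|[z' /AO/O2O[[_ ?] _] <-//]].
- move=> z [/Ay//|[z' /Ay[c Hc ->] <-]].
  by exists (b * c) => //; exact: near_idM.
move=> v; have [z Az zv] := Av v.
have zL B' : B' \in L -> ~ agree ds B' z v /\ ~ agree ds B' (b z) v.
  move=> /L2L[B2 B2L2 B2B']; have nzv := zv B2 B2L2.
  split=> h; apply: nzv; first exact: agreeS B2B' h.
  exact: agree_trans (L2agree _ _ B2L2 (AO _ Az)) (agreeS B2B' h).
have [Bzv|nBzv] := pselect (agree ds B z v).
  exists (b z); first by right; exists z.
  move=> B'; rewrite in_cons => /orP[/eqP-> Bbzv|/zL[]//].
  apply: (O1nb z); first by apply: O2O; exact: AO.
  exact: agree_trans Bzv (agree_sym Bbzv) p Bpu.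
exists z; first by left.
by move=> B'; rewrite in_cons => /orP[/eqP->|/zL[]].
Qed.

(** Shattering applied to a point of the shattering set itself gives two points
of one [near_id]-orbit that disagree on every piece. *)
Lemma near_id_not_free : False.
Proof.
have [|L LT Lagree] := @unsplit_agree ds setT ds_nip openT; first by exists 1.
have [|y [A [_ Ay Av]]] := @exists_shattering L setT openT minN.1.
  by move=> B /LT[oB _ [_ [p _ <-] Bp]]; split=> //; exists p.
have [z0 Az0 _] := Av y; have [z Az nz] := Av z0.
have [[b0' Hb0' z0E] [b Hb zE]] := (Ay z0 Az0, Ay z Az).
have [B BL Bz] := Lagree z _ (near_idM Hb0' (near_idV Hb)).
apply: (nz B BL); move: Bz; rewrite zE /= autVK -z0E.
by [].
Qed.

End NearIdentity.

Lemma near_id_trivial (b : aut N) : near_id b -> b = 1.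
Proof.
move=> Hb; apply: contrapT => b1.
have bfree x : b x <> x.
  move=> bx; apply: b1; apply: aut_ext => y; apply: contrapT => /nip_separated.
  move=> [D [[oD oDC _] Db nD]].
  have [||g [Dg nDg]] := @dense_fact x ([set z | D (b z)] `&` ~` D).
  - by apply: openI => //; exact: open_aut.
  - by exists y.
  by apply: nDg; move: Dg; rewrite /= aut_equivariant bx.
have sep x : exists D, [/\ nip_clopen D, D (b x) & ~ D x].
  exact: nip_separated.
have [D DP] := choice sep.
have [||s sP] := @compact_finite_cover _ (@fspace_compact _ N) _
    (fun x => [set z | D x (b z)] `&` ~` D x).
- move=> x; have [[oD oDC _] _ _] := DP x.
  by apply: openI => //; exact: open_aut.
- by move=> x; exists x; have [] := DP x.
apply: (@near_id_not_free b Hb [seq D x | x <- s]).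
  by move=> _ /mapP[x _ ->]; have [] := DP x.
move=> x xb; have [y ys [Dbx nDx]] := sP x.
by apply: nDx; apply/(xb (D y)) => //; exact: map_f.
Qed.

End TameMinimalFlow.

(** * Minimal left ideals of the enveloping semigroup *)

Lemma tau_open_hit (G : groupType) (N : flow G) (V W : set N) :
  open V -> open W -> tau_open [set h : aut N | exists x, V x /\ W (h x)].
Proof.
move=> oV oW h clh [x [Vx Whx]].
have [|[_ _] [[k nk [z _ [<- <-]]] [Vz Wkz]]] :=
    clh (x, h x) (ex_intro2 _ _ x I erefl) (V `*` W).
  by exists (V, W) => //; split; apply: open_nbhs_nbhs.
by apply: nk; exists z.
Qed.

Lemma nonseparated_near_id (G : groupType) (X : flow G)
    (N : minimal_subflow (enveloping_semigroup X)) (p q : ellis_group N) :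
  cluster (nbhs p) q -> near_id (p^-1 * q : aut N).
Proof.
move=> pq Q V1 V2 oQ [x Qx] oV1 oV2 [y [V1y V2y]].
pose m (A : set N) := [set z | A (((p : aut N)^-1%g : aut N) z)].
have om A : open A -> open (m A) by exact: open_aut.
have hit_open V W : open V -> open W -> open (([set h : aut N |
    exists x, V x /\ W (h x)]) : set (ellis_group N)) by exact: tau_open_hit.
have [||h [[x' [Qx' Qhx']] [y' [V1y' V2hy']]]] := pq
    ([set h : aut N | exists x, Q x /\ m Q (h x)] : set (ellis_group N))
    ([set h : aut N | exists x, V1 x /\ m V2 (h x)] : set (ellis_group N)).
- apply: open_nbhs_nbhs; split; first exact: hit_open (om _ oQ).
  by exists x; rewrite /m /= autVK.
- apply: open_nbhs_nbhs; split; first exact: hit_open (om _ oV2).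
  by exists y.
by exists ((p : aut N)^-1 * h); split; [exists x'|exists y'].
Qed.

Section EllisSemigroup.
Variables (G : groupType) (X : flow G).
Variable N : minimal_subflow (enveloping_semigroup X).

Definition ev (n : N) : power_flow X := set_val (set_val n).

Lemma ev_inj : injective ev.
Proof. by move=> n m /val_inj/val_inj. Qed.

Lemma ev_fact g n x : ev (fact g n) x = fact g (ev n x).
Proof. by []. Qed.

Lemma ev_continuous : continuous ev.
Proof.
move=> n; apply: (@continuous_comp _ _ _ (set_val : N -> enveloping_semigroup X)
  (set_val : enveloping_semigroup X -> power_flow X)).
  exact: sf_val_continuous.
exact: (@sf_val_continuous _ _ (enveloping_semigroup X)).
Qed.

Lemma ev_enveloping n : enveloping_set (ev n).
Proof. exact: set_mem (valP (set_val n)). Qed.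

Lemma open_ev (A : set N) : open A ->
  exists2 V : set (power_flow X), open V & A = [set n | V (ev n)].
Proof. by move=> [_ [V oV <-] <-]; exists V. Qed.

Lemma power_continuous (T : topologicalType) (F : T -> power_flow X) :
  (forall x, continuous (fun t => F t x)) -> continuous F.
Proof.
move=> cF t; have FF : Filter (F @ nbhs t) by exact: fmap_filter.
apply/cvg_sup => x; apply/cvg_image.
  by rewrite predeqE => y; split=> // _; exists (fun=> y).
move=> U nU; exists ((fun k : X -> X => k x) @^-1` U); first exact: cF.
by rewrite image_preimage //; rewrite predeqE => y; split=> // _; exists (fun=> y).
Qed.

Lemma precomp_continuous (h : X -> X) :
  continuous (fun f : power_flow X => (f \o h) : power_flow X).
Proof. by apply: power_continuous => x f; exact: pow_proj_continuous. Qed.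

Lemma closed_image (T T' : topologicalType) (f : T -> T') (A : set T) :
  compact [set: T] -> hausdorff_space T' -> continuous f -> closed A ->
  closed (f @` A).
Proof.
move=> cT hT' cf cA; apply: compact_closed => //.
apply: continuous_compact; first exact: continuous_subspaceT.
exact: subclosed_compact cA cT _.
Qed.

Lemma comp_ex (f : power_flow X) (m : N) : enveloping_set f ->
  exists k, ev k = f \o ev m.
Proof.
pose A := [set f : power_flow X | range ev (f \o ev m)].
have cA : closed A.
  apply: (closed_comp (f := fun f : power_flow X => (f \o ev m) : power_flow X)).
    by move=> x _; exact: precomp_continuous.
  apply: closed_image; [exact: fspace_compact|exact: fspace_hausdorff|
    exact: ev_continuous|exact: closedT].
have GA : range (fun g : G => (fun x : X => fact g x) : power_flow X) `<=` A.
  by move=> _ [g _ <-]; exists (fact g m).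
by move=> /(closureS GA); rewrite -(closure_id _).1 // => -[k _ kE]; exists k.
Qed.

(** Composition of an element of the enveloping semigroup with an element of
its left ideal [N], made total by a default value. *)
Definition act (f : power_flow X) (m : N) : N :=
  if pselect (exists k, ev k = f \o ev m) is left P then projT1 (cid P) else m.

Lemma ev_act f m : enveloping_set f -> ev (act f m) = f \o ev m.
Proof.
move=> /(comp_ex m) ex; rewrite /act; case: pselect => // P.
exact: projT2 (cid P).
Qed.

Definition emul (n m : N) : N := act (ev n) m.

Lemma ev_emul n m : ev (emul n m) = ev n \o ev m.
Proof. by apply: ev_act; exact: ev_enveloping. Qed.

Lemma emulA n m k : emul n (emul m k) = emul (emul n m) k.
Proof. by apply: ev_inj; rewrite !ev_emul. Qed.

Lemma emul_fact g n m : emul (fact g n) m = fact g (emul n m).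
Proof.
by apply: ev_inj; rewrite ev_emul; apply/funext => x; rewrite ev_fact ev_emul.
Qed.

Lemma emul_continuous m : continuous (emul^~ m).
Proof.
apply/continuousP => A /open_ev[V oV ->].
pose comp_m (f : power_flow X) : power_flow X := f \o ev m.
rewrite (_ : _ @^-1` _ = ev @^-1` (comp_m @^-1` V)).
  have /continuousP := ev_continuous; apply.
  by have /continuousP := @precomp_continuous (ev m); apply.
by rewrite predeqE => n /=; rewrite ev_emul.
Qed.

Lemma emul_surj m n : exists k, emul k m = n.
Proof.
have cR : closed (range (emul^~ m)).
  apply: closed_image; [exact: fspace_compact|exact: fspace_hausdorff|
    exact: emul_continuous|exact: closedT].
suff : range (emul^~ m) n by move=> [k _ <-]; exists k.
apply: contrapT => nR.
have [||k [nk [g _ gk]]] := (ms_minimal N).2 (emul m m) (~` range (emul^~ m)).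
- by exists n.
- by rewrite openC.
by apply: nk; exists (fact g m); rewrite // emul_fact.
Qed.

(** Ellis-Numakura: a minimal closed subsemigroup [M] satisfies [M e = M] for
each [e] in [M], and then the elements that fix [e] from the left form a closed
subsemigroup as well. *)
Lemma exists_idempotent : exists e : N, emul e e = e.
Proof.
pose P := [set A : set N | forall x y, A x -> A y -> A (emul x y)].
have [|M [cM [e Me] PM Mmin]] :=
    exists_minimal_closed (@fspace_compact _ N) (P := P) (ms_minimal N).1.
  by move=> C CP x y Cx Cy A CA; apply: CP => //; [exact: Cx|exact: Cy].
exists e.
have [x Mx xe] : [set emul x e | x in M] e.
  apply: Mmin => //.
  - apply: closed_image => //; [exact: fspace_compact|exact: fspace_hausdorff|
      exact: emul_continuous].
  - by exists (emul e e); exists e.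
  - move=> _ _ [x Mx <-] [y My <-]; exists (emul (emul x e) y); last by rewrite !emulA.
    exact: (PM (emul x e) y (PM x e Mx Me) My).
  - by move=> _ [x Mx <-]; exact: PM.
suff [] : (M `&` [set x | emul x e = e]) e by [].
apply: (Mmin (M `&` [set x | emul x e = e])) => //.
- apply: closedI => //.
  apply: (closed_comp (f := emul^~ e) (D := [set e])).
    by move=> y _; exact: emul_continuous.
  exact: accessible_closed_set1 (hausdorff_accessible (@fspace_hausdorff _ N)) e.
- by exists x.
- move=> y z [My ye] [Mz ze]; split; first exact: PM.
  by rewrite /= -emulA ze.
Qed.

Lemma idempotent_right_id e n : emul e e = e -> emul n e = n.
Proof. by move=> ee; have [k <-] := emul_surj e n; rewrite -emulA ee. Qed.

(** Right multiplication by [m] is onto, hence has some [k] with [k m]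
idempotent; then [m k] is idempotent too, and idempotents of a minimal left
ideal are right identities. *)
Lemma right_mul_aut m : exists p : aut N, forall n, p n = emul n m.
Proof.
have [e ee] := exists_idempotent.
have [k0 k0m] := emul_surj m e; pose k := emul e k0.
have km : emul k m = e by rewrite -emulA k0m.
have mk : emul (emul m k) (emul m k) = emul m k.
  by rewrite emulA -(emulA m) km (idempotent_right_id _ ee).
have inv : exists2 h : N -> N, continuous h &
    cancel (emul^~ m) h /\ cancel h (emul^~ m).
  exists (emul^~ k); first exact: emul_continuous.
  by split=> n; rewrite -emulA ?km (idempotent_right_id _ mk, idempotent_right_id _ ee).
by exists (Aut (fun g n => emul_fact g n m) (@emul_continuous m) inv).
Qed.

Lemma left_mul_approx u (xs : seq N) (ds : seq (set N)) : nip_list ds ->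
  exists g : G, forall x, x \in xs -> same_type ds (fact g x) (emul u x).
Proof.
move=> dsN.
have ball (Dx : set N * N) : exists V : set (power_flow X), Dx.1 \in ds ->
    [/\ open V, V (ev u) &
    forall f, enveloping_set f -> V f -> (Dx.1 (act f Dx.2) <-> Dx.1 (emul u Dx.2))].
  case: Dx => D x /=.
  have [Dds|nDds] := pselect (D \in ds); last by exists setT.
  have [oD oDC _] := dsN D Dds.
  have [A [oA Au AD]] : exists A : set N, [/\ open A, A (emul u x) &
      forall y, A y -> (D y <-> D (emul u x))].
    have [Du|nDu] := pselect (D (emul u x)); first by exists D.
    by exists (~` D).
  have [V oV AE] := open_ev oA.
  exists [set f : power_flow X | V (f \o ev x)] => _; split.
  - by have /continuousP := @precomp_continuous (ev x); apply.
  - by rewrite /= -ev_emul; rewrite AE in Au.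
  - by move=> f Ef Vf; apply: AD; rewrite AE /= ev_act.
have [V VP] := choice ball.
pose W := [set f : power_flow X |
  forall Dx, Dx \in [seq (D, x) | D <- ds, x <- xs] -> V Dx f].
have memE Dx : Dx \in [seq (D, x) | D <- ds, x <- xs] -> Dx.1 \in ds.
  by move=> /allpairsP[[D x] [? ? ->]].
have oW : open W by apply: open_seq_forall => Dx /memE/VP[].
have [|_ [[g _ <-] Wg]] := ev_enveloping (n := u) (B := W).
  by apply: open_nbhs_nbhs; split=> // Dx /memE/VP[].
exists g => x xxs D Dds.
have Ef : enveloping_set ((fun x : X => fact g x) : power_flow X).
  by apply: subset_closure; exists g.
have [_ _ /(_ _ Ef)] := VP (D, x) Dds.
rewrite /= (_ : act _ x = fact g x); last by apply: ev_inj; rewrite ev_act.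
by apply; apply: Wg; apply/allpairsP; exists (D, x).
Qed.

Lemma ellis_hausdorff :
  (forall x y : N, x <> y -> exists D, [/\ nip_clopen D, D x & ~ D y]) ->
  hausdorff_space (ellis_group N).
Proof.
move=> sep p q /nonseparated_near_id pq.
have [u uP] := exists_recurrent (H := [set: aut N]) (ms_minimal N).1 I (fun _ _ _ _ => I).
have orbit_u x : exists p : aut N, emul u x = p u.
  by have [r rE] := right_mul_aut x; exists r; rewrite rE.
have := near_id_trivial (ms_minimal N) sep uP orbit_u (@left_mul_approx u) pq.
move=> /(congr1 (fun r : aut N => (p : aut N) * r)).
by rewrite mulVKg mulg1 => ->.
Qed.

End EllisSemigroup.

(** * Finite supports of formulas and ultrapowers *)

Section Support.
Variable L : language.

Lemma family_support (V : Type) k (args : 'I_k -> term L V) :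
    (forall i, exists2 A : set V, finite_set A &
       forall (M : structure L) (v w : V -> M), (forall x, A x -> v x = w x) ->
         Defs.eval v (args i) = Defs.eval w (args i)) ->
  exists2 A : set V, finite_set A &
    forall (M : structure L) (v w : V -> M), (forall x, A x -> v x = w x) ->
      forall i, Defs.eval v (args i) = Defs.eval w (args i).
Proof.
move=> argsA; have [F FP] := choice (fun i => let: ex_intro2 A fA AP := argsA i in
  ex_intro (fun A => _ /\ _) A (conj fA AP)).
exists (\bigcup_(i in [set: 'I_k]) F i).
  by apply: bigcup_finite => // i _; have [] := FP i.
by move=> M v w vw i; have [_] := FP i; apply => x Fx; apply: vw; exists i.
Qed.

Lemma term_support (V : Type) (t : term L V) : exists2 A : set V, finite_set A &
  forall (M : structure L) (v w : V -> M), (forall x, A x -> v x = w x) ->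
    Defs.eval v t = Defs.eval w t.
Proof.
elim: t => [x|f args /family_support[A fA AP]].
  by exists [set x] => // M v w vw /=; exact: vw.
by exists A => // M v w vw /=; congr (fun_interp _ _ _); apply/funext; exact: AP.
Qed.

Lemma formula_support (V : Type) (phi : formula L V) :
  exists2 A : set V, finite_set A &
  forall (M : structure L) (v w : V -> M), (forall x, A x -> v x = w x) ->
    (sat phi v <-> sat phi w).
Proof.
elim: phi => {V} [V s t|V r args|V p IH|V p IHp q IHq|V p IH].
- have [A fA At] := term_support t; have [B fB Bs] := term_support s.
  exists (A `|` B); first by rewrite finite_setU.
  move=> M v w vw /=; rewrite (At _ v w) ?(Bs _ v w) // => x xA; apply: vw;
    by [left|right].
- have [A fA Aargs] := family_support (fun j => term_support (args j)).
  exists A => // M v w vw /=.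
  by rewrite (_ : (fun i => Defs.eval v (args i)) = fun i => Defs.eval w (args i)) //;
    apply/funext; exact: Aargs.
- by have [A fA Ap] := IH; exists A => // M v w vw /=; rewrite (Ap _ _ _ vw).
- have [A fA Ap] := IHp; have [B fB Bq] := IHq.
  exists (A `|` B); first by rewrite finite_setU.
  by move=> M v w vw /=; rewrite (Ap _ v w) ?(Bq _ v w) // => x xA; apply: vw;
    [right|left].
- have [A fA Ap] := IH; exists (Some @^-1` A).
    by apply: finite_preimage => // x y _ _ [].
  move=> M v w vw /=; have E a x : A x -> oapp v a x = oapp w a x.
    by case: x => [x|//] Ax /=; exact: vw.
  by split=> -[a /(Ap M _ _ (E a))]; exists a.
Qed.

(** Parameters become a tuple of fixed length, as required by the definition of
IP.  The extra entry of the tuple keeps its index type inhabited. *)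
Lemma finite_parameters (M : structure L) (V : Type) (phi : formula L (V + M)) :
  exists k (c : 'I_k -> M) (psi : formula L (V + 'I_k)), forall v : V -> M,
    sat psi (join_val v c) <-> sat phi (join_val v id).
Proof.
have [A fA Aphi] := formula_support phi; have [c0] := carrier_inhabited M.
have fC : finite_set ((inr : M -> V + M) @^-1` A).
  by apply: finite_preimage => // x y _ _ [].
have [s sE] := (@finite_seqP {classic M} _).1 fC.
exists (size s).+1, (nth c0 s).
pose f (x : V + M) : V + 'I_(size s).+1 := match x with
  | inl x => inl x | inr c => inr (inord (index (c : {classic M}) s)) end.
exists (rename phi f) => v; rewrite sat_rename; apply: Aphi => -[x|c] //= Ac.
have cs : (c : {classic M}) \in s.
  by have : ((inr : M -> V + M) @^-1` A) c by []; rewrite sE.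
rewrite inordK; last by rewrite ltnS index_size.
exact: (@nth_index {classic M}).
Qed.

End Support.

Section Ultrapower.
Variables (L : language) (C : structure L).
Variable U : set_system nat.
Hypothesis UU : UltraFilter U.

Definition ueq (f g : nat -> C) : Prop := U [set i | f i = g i].

Lemma ueq_refl f : ueq f f.
Proof. by apply: filterS filterT => i. Qed.

Lemma ueq_sym f g : ueq f g -> ueq g f.
Proof. by apply: filterS => i /= ->. Qed.

Lemma ueq_trans f g h : ueq f g -> ueq g h -> ueq f h.
Proof. by move=> fg gh; apply: filterS (filterI fg gh) => i [/= ->]. Qed.

Definition ultra_carrier : Type := {s : set (nat -> C) | exists f, s = ueq f}.

Definition ucls (f : nat -> C) : ultra_carrier :=
  exist _ (ueq f) (ex_intro _ f erefl).

(** Representatives make the Los theorem a statement about one valuation in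
each factor. *)
Definition urep (a : ultra_carrier) : nat -> C := projT1 (cid (svalP a)).

Lemma urepK a : ucls (urep a) = a.
Proof.
have E : sval a = ueq (urep a) := projT2 (cid (svalP a)).
case: a E => s sP /= E; rewrite /ucls.
by apply: eq_sig_hprop => [?|/=]; [exact: Prop_irrelevance|rewrite -E].
Qed.

Lemma ucls_eq f g : ucls f = ucls g <-> ueq f g.
Proof.
split=> [[E]|fg]; first by rewrite E; exact: ueq_refl.
apply: eq_sig_hprop => [?|/=]; first exact: Prop_irrelevance.
rewrite predeqE => h; split; last exact: ueq_trans.
by apply: ueq_trans; exact: ueq_sym.
Qed.

Lemma urep_cls f : ueq (urep (ucls f)) f.
Proof. by apply/ucls_eq; rewrite urepK. Qed.

Definition ultrapower : structure L := @Structure L ultra_carrier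
  (fun h args => ucls (fun i => fun_interp C h (fun j => urep (args j) i)))
  (fun r args => U [set i | rel_interp C r (fun j => urep (args j) i)])
  (let: inhabits c := carrier_inhabited C in inhabits (ucls (fun=> c))).

Lemma eval_ultrapower V (t : term L V) (v : V -> ultrapower) :
  Defs.eval v t = ucls (fun i => Defs.eval (fun x => urep (v x) i) t).
Proof.
elim: t => [x|h args IH] /=; first by rewrite urepK.
apply/ucls_eq.
have : U [set i | forall j, urep (Defs.eval v (args j)) i =
    Defs.eval (fun x => urep (v x) i) (args j)].
  by apply: filter_forall => j; rewrite IH; exact: urep_cls.
by apply: filterS => i E; congr (fun_interp _ _ _); apply/funext.
Qed.

Lemma ultra_not (A : set nat) : U (~` A) <-> ~ U A.
Proof.
split=> [UC UA|nUA]; last by have [] := in_ultra_setVsetC A UU.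
by have [i []] := filter_ex (filterI UA UC).
Qed.

Lemma los V (phi : formula L V) (v : V -> ultrapower) :
  sat phi v <-> U [set i | sat phi (fun x => urep (v x) i)].
Proof.
elim: phi v => {V} [V s t|V r args|V p IH|V p IHp q IHq|V p IH] v /=.
- by rewrite !eval_ultrapower ucls_eq.
- have Eargs : U [set i | forall j, urep (Defs.eval v (args j)) i =
      Defs.eval (fun x => urep (v x) i) (args j)].
    by apply: filter_forall => j; rewrite eval_ultrapower; exact: urep_cls.
  split=> UA; apply: filterS (filterI Eargs UA) => i [E] /=.
    by congr (rel_interp _ _ _); apply/funext => j; rewrite E.
  by congr (rel_interp _ _ _); apply/funext => j; rewrite E.
- by rewrite IH -ultra_not.
- rewrite IHp IHq; split=> [[Up Uq]|Upq]; first exact: filterI.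
  by split; apply: filterS Upq => i [].
- have E a i : (fun x => urep (oapp v a x) i) = oapp (fun x => urep (v x) i) (urep a i).
    by apply/funext => -[].
  split=> [[a /IH Ua]|Uex].
    by apply: filterS Ua => i /=; rewrite E; exists (urep a i).
  have wit i : exists a : C, (exists a, sat p (oapp (fun x => urep (v x) i) a)) ->
      sat p (oapp (fun x => urep (v x) i) a).
    have [[a pa]|np] := pselect (exists a, sat p (oapp (fun x => urep (v x) i) a)).
      by exists a.
    by have [c] := carrier_inhabited C; exists c.
  have [f fP] := choice wit.
  exists (ucls f); apply/IH; apply: filterS (filterI Uex (urep_cls f)) => i [ex fE] /=.
  by rewrite E fE; exact: fP.
Qed.

Lemma los_cls (V : finType) (phi : formula L V) (w : V -> nat -> C) :
  sat (M := ultrapower) phi (fun x => ucls (w x)) <-> U [set i | sat phi (w^~ i)].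
Proof.
have Ew : U [set i | forall x, urep (ucls (w x)) i = w x i].
  by apply: filter_forall => x; exact: urep_cls.
rewrite los; split=> UA; apply: filterS (filterI Ew UA) => i [E] /=;
  by congr (sat phi _); apply/funext => x; rewrite E.
Qed.

End Ultrapower.

(** * Externally definable sets in NIP structures *)

Section ExternallyDefinable.
Variables (L : language) (M C : structure L) (e : M -> C).
Hypothesis e_elem : elementary e.
Variable G : definable_group M.
Notation n := (dg_dim G).

Lemma dg_elt_inj (x y : dg_elt G) : sval x = sval y -> x = y.
Proof. by move=> xy; apply: eq_sig_hprop => // z; exact: Prop_irrelevance. Qed.

Lemma mul_graph : exists Gam : formula L (('I_n + 'I_n) + 'I_n + M),
  forall (x y : dg_elt G) (z : 'I_n -> M),
    sat Gam (join_val (join_val (join_val (sval x) (sval y)) z) id) <->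
    z = sval (x * y).
Proof.
have [Gam GamE] := dg_mul_definable G; exists Gam => x y z.
have := congr1 (fun P : set _ => P (join_val (join_val (sval x) (sval y)) z)) GamE.
move=> /= <-.
split=> [[x' [y' E]]|->]; last by exists x, y.
have <- : x' = x.
  by apply: dg_elt_inj; apply/funext => i; have /= := congr1 (@^~ (inl (inl i))) E.
have <- : y' = y.
  by apply: dg_elt_inj; apply/funext => i; have /= := congr1 (@^~ (inl (inr i))) E.
by apply/funext => i; exact: (congr1 (@^~ (inr i)) E).
Qed.

(** The graph of multiplication need not define a function on [C], but at
arguments from [M] it has the right value, since that it does not have any other
value is expressible with parameters in [M]. *)
Lemma mul_graph_ext : exists Gam : formula L (('I_n + 'I_n) + 'I_n + M),
  forall (x y : dg_elt G) (z : 'I_n -> C),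
    sat Gam (join_val (join_val (join_val (e \o sval x) (e \o sval y)) z) e) <->
    z = e \o sval (x * y).
Proof.
have [Gam GamP] := mul_graph; exists Gam => x y z.
split=> [zGam|->]; last first.
  have /e_elem := (GamP x y _).2 erefl; congr (sat Gam _).
  by apply/funext => -[[[]|]|].
apply/funext => i; apply: contrapT => zi.
pose f (j : ('I_n + 'I_n) + 'I_n + M) : M + 'I_n := match j with
  | inl (inl (inl j)) => inl (sval x j) | inl (inl (inr j)) => inl (sval y j)
  | inl (inr j) => inr j | inr m => inl m end.
have [psi psiP] := ex_block (FAnd (rename Gam f)
  (FNot (FEq (Var L (inr i)) (Var L (inl (sval (x * y) i)))))).
have psiC : sat psi (e \o id).
  rewrite psiP; exists z; split=> //; rewrite sat_rename.
  by move: zGam; congr (sat Gam _); apply/funext => -[[[]|]|].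
move/e_elem: psiC; rewrite psiP => -[w /= []]; rewrite sat_rename => wGam.
apply; suff -> : w = sval (x * y) by [].
by apply/GamP; move: wGam; congr (sat Gam _); apply/funext => -[[[]|]|].
Qed.

Lemma translate_formula (phi : formula L ('I_n + C)) :
  exists psi : formula L ('I_n + 'I_n + C), forall x y : dg_elt G,
    sat psi (join_val (join_val (e \o sval x) (e \o sval y)) id) <->
    sat phi (join_val (e \o sval (x * y)) id).
Proof.
have [Gam GamP] := mul_graph_ext.
pose f (j : ('I_n + 'I_n) + 'I_n + M) : ('I_n + 'I_n + C) + 'I_n := match j with
  | inl (inl j) => inl (inl j) | inl (inr j) => inr j | inr m => inl (inr (e m)) end.
pose f' (j : 'I_n + C) : ('I_n + 'I_n + C) + 'I_n := match j with
  | inl j => inr j | inr c => inl (inr c) end.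
have [psi psiP] := ex_block (FAnd (rename Gam f) (rename phi f')).
exists psi => x y; rewrite psiP /=.
pose v := join_val (join_val (e \o sval x) (e \o sval y)) id.
have vf z : join_val v z \o f =
    join_val (join_val (join_val (e \o sval x) (e \o sval y)) z) e.
  by apply/funext => -[[[]|]|].
have vf' z : join_val v z \o f' = join_val z id by apply/funext => -[].
split=> [[z [/sat_rename + /sat_rename]]|xy].
  by rewrite vf vf' => /GamP ->.
exists (e \o sval (x * y)); split; apply/sat_rename; rewrite ?vf ?vf' //.
exact/GamP.
Qed.

(** Finite independence patterns in [C] become one infinite pattern in an
ultrapower of [C] over the index set of pattern lengths: the row for [I] is the
class of the sequence of elements realizing longer and longer initial parts of
[I]. *)
Lemma NIP_no_independent_translates (S : set (dg_elt G)) (g : nat -> dg_elt G) :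
  NIP_structure M -> ext_definable e S ->
  ~ (forall (t : nat) (I : set nat),
      exists h, forall k, (k < t)%N -> (S (g k * h) <-> I k)).
Proof.
move=> M_NIP [_ [phi ->] ->] indep.
have [psi psiP] := translate_formula phi.
have [p [c [theta thetaP]]] := finite_parameters psi.
pose f (j : 'I_n + 'I_n + 'I_p) : 'I_n + 'I_(n + p) := match j with
  | inl (inl i) => inl i | inl (inr i) => inr (lshift p i)
  | inr l => inr (rshift n l) end.
have [U [UU Uoo]] := @ultraFilterLemma nat \oo _.
have wit (tI : nat * set nat) : exists h, forall k, (k < tI.1)%N ->
    (sat phi (join_val (e \o sval (g k * h)) id) <-> tI.2 k).
  exact: indep.
have [h hP] := choice wit.
pose w (k : nat) (I : set nat) (x : 'I_n + 'I_(n + p)) (t : nat) : C := match x with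
  | inl i => e (sval (g k) i)
  | inr j => match fintype.split j with inl i => e (sval (h (t, I)) i) | inr l => c l end
  end.
apply: (M_NIP n (n + p)%N (rename theta f)); exists (ultrapower C U).
  move=> s Ms; rewrite /theory_of /= /holds (los UU).
  have sC v : sat s (v : void -> C).
    have := (@e_elem _ s (of_void M)).1 Ms; congr (sat s _).
    by apply/funext => -[].
  by apply: filterS filterT => t _ /=; exact: sC.
(* [w] depends on [I] only in the [inr] part and on [k] only in the [inl] part,
   whence the dummy arguments. *)
exists (fun k i => ucls U (w k set0 (inl i))),
  (fun I j => ucls U (w 0%N I (inr j))) => k I.
have -> : join_val (fun i => ucls U (w k set0 (inl i)))
    (fun j => ucls U (w 0%N I (inr j))) = fun x => ucls U (w k I x).
  by apply/funext => -[].
rewrite (los_cls UU).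
have wE t : (k < t)%N -> (sat (rename theta f) ((w k I)^~ t) <-> I k).
  move=> kt; have /= hk := hP (t, I) k kt; rewrite sat_rename -hk -psiP -thetaP.
  suff -> : (w k I)^~ t \o f =
    join_val (join_val (e \o sval (g k)) (e \o sval (h (t, I)))) c by [].
  apply/funext => -[[i|i]|l] //=.
    by rewrite (unsplitK (inl i)).
  by rewrite (unsplitK (inr l)).
have Ukt : U [set t | (k < t)%N] by apply: Uoo; exact: nbhs_infty_gt.
split=> [Uw|Ik].
  by have [t [kt /= /(wE t kt)]] := filter_ex (filterI Ukt Uw).
by apply: filterS Ukt => t kt /=; exact/(wE t kt).
Qed.

End ExternallyDefinable.

(** Types of the Stone space are finitely satisfiable in the group, which brings
independence on the flow down to independence of group elements. *)
Lemma stone_realize (T : Type) (B : set_algebra T) (p : stone B) (A : nat -> set T) t :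
  (forall k, alg_sets B (A k)) ->
  exists x, forall k, (k < t)%N -> (A k x <-> st_sets p (A k)).
Proof.
move=> BA.
suff [R pR RP] : exists2 R, st_sets p R &
    forall x, R x -> forall k, (k < t)%N -> (A k x <-> st_sets p (A k)).
  have [[x Rx]|R0] := pselect (R !=set0); first by exists x; exact: RP.
  by case: (@st_set0 _ _ p); rewrite -(_ : R = set0) //; apply/seteqP; split=> // x Rx;
    case: R0; exists x.
elim: t => [|t [R pR RP]]; first by exists setT => //; exact: st_setT.
have [pA|pA] := st_ultra p (BA t).
  exists (R `&` A t); first exact: st_setI.
  move=> x [Rx Ax] k; rewrite ltnS leq_eqVlt => /orP[/eqP->|]; last exact: RP.
  by split.
exists (R `&` ~` A t); first exact: st_setI.
move=> x [Rx Ax] k; rewrite ltnS leq_eqVlt => /orP[/eqP->|]; last exact: RP.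
by split=> // pA'; move/(stone_setC p (BA t)): pA.
Qed.

Lemma subflow_factE (G : groupType) (X : flow G) (Y : subflow X) g (y : Y) :
  set_val (fact g y) = fact g (set_val y) :> X.
Proof. by []. Qed.

Lemma stone_factE (G : groupType) (B : set_algebra G)
    (Btrans : forall g S, alg_sets B S -> alg_sets B (left_translate g S))
    g (p : stone_flow Btrans) S :
  st_sets (fact g p : stone B) S = st_sets (p : stone B) (left_translate g^-1 S).
Proof. by []. Qed.

Lemma ellis_nip_separated (L : language) (M C : structure L) (e : M -> C)
    (e_elem : elementary e) (M_NIP : NIP_structure M) (G : definable_group M)
    (Y : subflow (ext_type_flow G e_elem))
    (N : minimal_subflow (enveloping_semigroup Y)) (x y : N) :
  x <> y -> exists D, [/\ nip_clopen D, D x & ~ D y].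
Proof.
set B := ext_definable_algebra e G.
pose val_at (z : N) (xi : Y) : stone B := set_val (ev z xi).
move=> xy; have [xi xyxi] : exists xi, ev x xi <> ev y xi.
  apply: contrapT => nxi; apply: xy; apply: ev_inj; apply/funext => xi.
  by apply: contrapT => ne; apply: nxi; exists xi.
have [S [BS xS yS]] : exists S, [/\ alg_sets B S, st_sets (val_at x xi) S &
    ~ st_sets (val_at y xi) S].
  apply: contrapT => nS; apply: xyxi; apply: val_inj; apply: stone_ext.
  rewrite predeqE => S; split=> [xS|yS]; apply: contrapT => nS'; apply: nS.
    by exists S; split=> //; exact: st_sub xS.
  have BS := st_sub yS; exists (~` S); split; first exact: alg_setC.
    exact/stone_setC.
  by move=> /(stone_setC _ BS).
pose D := [set z : N | st_sets (val_at z xi) S].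
have openD S' : alg_sets B S' -> open [set z : N | st_sets (val_at z xi) S'].
  move=> BS'; have /continuousP cval : continuous (fun z : N => val_at z xi).
    move=> z; apply: (@continuous_comp _ _ _ (fun z : N => ev z xi) set_val).
      apply: (@continuous_comp _ _ _ (@ev _ _ N) (fun f => f xi)).
        exact: ev_continuous.
      exact: pow_proj_continuous.
    exact: sf_val_continuous.
  exact: (cval _ (stone_basic_open BS')).
exists D; split=> //; split; first exact: openD.
  rewrite (_ : ~` D = [set z : N | st_sets (val_at z xi) (~` S)]).
    exact/openD/alg_setC.
  by rewrite predeqE => z; split=> /(stone_setC _ BS).
move=> [g gD].
apply: (@NIP_no_independent_translates _ M C e e_elem G S g M_NIP BS) => t I.
have [z zP] := gD t I.
have BgS k : alg_sets B (left_translate (g k)^-1 S).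
  exact: ext_definable_translate.
have [h hP] := stone_realize (val_at z xi) t BgS.
exists h => k kt; rewrite -(zP k kt).
(* The action is unfolded one layer at a time; comparing both sides by conversion
   alone is prohibitively slow. *)
have valE : val_at (fact (g k) z) xi =
    fact (g k) (val_at z xi : ext_type_flow G e_elem).
  by rewrite /val_at ev_fact subflow_factE.
change (D (fact (g k) z)) with (st_sets (val_at (fact (g k) z) xi) S).
rewrite valE stone_factE.
rewrite -(hP k kt).
have -> : left_translate (g k)^-1 S = [set x | S (g k * x)].
  by rewrite left_translateE invgK.
exact: iff_refl.
Qed.

(** * The Ellis group *)

Theorem theorem11p9 (L : language) (M C : structure L) (e : M -> C)
    (e_elem : elementary e) (C_sat : saturated_over M C)
    (M_NIP : NIP_structure M) (G : definable_group M)
    (Y : minimal_subflow (ext_type_flow G e_elem))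
    (N : minimal_subflow (enveloping_semigroup Y)) :
  hausdorff_space (ellis_group N).
Proof. by apply: ellis_hausdorff; exact: ellis_nip_separated. Qed.
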